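(* Let $\xi,\xi_1,\ldots,\xi_N$ be i.i.d. $\mathbb{R}^d$-valued random vectors, and suppose that the distribution of $\xi$ satisfies the following condition, where $\sigma$ is a finite measure on the unit sphere $S\subset\mathbb{R}^d$ and $\beta>\alpha>0$: for all Borel sets $B\subset S$ with $\sigma(\partial B)=0$, $$\mathbf{P}\left\{\frac{\xi}{\|\xi\|}\in B,\ \|\xi\|>x\right\}=\sigma(B)x^{-\alpha}+Cx^{-\beta}+o(x^{-\beta})\quad\text{as }x\to\infty.$$ Choose $$n=N^{2\zeta/(1+2\zeta)-\varepsilon},\qquad m=N^{1/(1+2\zeta)+\varepsilon},$$ where $\zeta=\min\left(\frac{\beta-\alpha}{\alpha},1\right)$ and $\varepsilon$ is an arbitrarily small positive constant. For a Borel set $B\subset S$ with $\sigma(\partial B)=0$, put $\eta_{m,i}=\mathbf{1}_B(\theta_{m,i})$, $i=1,\ldots,n$, and $$T_N=\frac{\sqrt n\left(\hat\sigma_N(B)-\tilde\sigma(B)\right)}{\left(\frac1n\sum_{i=1}^n\eta_{m,i}^2-\left(\frac1n\sum_{i=1}^n\eta_{m,i}\right)^2\right)^{1/2}},\qquad \hat\sigma_N(B)=\frac1n\sum_{i=1}^n\eta_{m,i}.$$ Then $T_N\Rightarrow\mathcal N(0,1)$ as $N\to\infty$.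
   Context: $\|\cdot\|$ is the Euclidean norm on $\mathbb{R}^d$, $S=\{x\in\mathbb{R}^d:\|x\|=1\}$, $\partial B$ is the boundary of $B$ in $S$, $\mathbf{1}_B$ is the indicator function of $B$, $\tilde\sigma(\cdot)=\sigma(\cdot)/\sigma(S)$ is the normalized spectral measure, $C$ is a constant, and $\Rightarrow$ denotes convergence in distribution. The sample $\xi_1,\ldots,\xi_N$ is divided into $n$ groups $G_{m,1},\ldots,G_{m,n}$, each containing $m$ random vectors; $n$ and $m$ are understood up to integer parts (for $r\in(0,1)$ the general setting is $n=[N^r]$, $m=[N/n]$, where $[a]$ is the integer part of $a$). For each $i$, $\xi_{m,i}$ denotes an element of the group $G_{m,i}$ with the largest norm, i.e. $\|\xi_{m,i}\|=\max\{\|\xi\|:\xi\in G_{m,i}\}$, and $\theta_{m,i}=\xi_{m,i}/\|\xi_{m,i}\|$.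
   Formalization: The set B is additionally assumed to satisfy 0 < σ(B) < σ(S); otherwise the claim fails: for B empty T_N is 0/0, and whenever σ(B) is 0 or σ(S), T_N has constant sign (or σ̃ is undefined), so it cannot converge to N(0,1). *)

(* Defs.v *)
From HB Require Import structures.
From mathcomp Require Export all_boot all_order all_algebra finmap.
From mathcomp Require Export all_classical all_reals all_analysis.
Export Order.TTheory GRing.Theory Num.Theory.
Export numFieldNormedType.Exports.

Set Implicit Arguments.
Unset Strict Implicit.
Unset Printing Implicit Defensive.

Local Open Scope classical_set_scope.
Local Open Scope ring_scope.

(* R^d with its Borel sigma-algebra.  The library topology on 'rV[R]_d is the
   product topology, which is also that of the Euclidean norm. *)
Notation borel_rV R d := (g_sigma_algebraType (@open 'rV[R]_d)).

Section euclidean.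
Context {R : realType} {d : nat}.
Implicit Types (v : 'rV[R]_d) (B : set 'rV[R]_d).

(* The norm `|v| of the library is the sup norm. *)
Definition enorm v : R := Num.sqrt (\sum_(i < d) v ord0 i ^+ 2).

(* Equal to 0, hence outside the sphere, when v = 0. *)
Definition direction v : 'rV[R]_d := (enorm v)^-1 *: v.

Definition sphere : set 'rV[R]_d := [set v | enorm v = 1].

(* Boundary in the subspace [sphere], for B included in it. *)
Definition sphere_boundary B : set 'rV[R]_d :=
  sphere `&` closure B `&` closure (sphere `\` B).

End euclidean.

Section probability.
Context {R : realType} {d : nat} {dO : measure_display}.
Context {Omega : measurableType dO} (P : probability Omega R).

Definition independent_vectors (xi : nat -> {RV P >-> borel_rV R d}) :=
  forall (J : {fset nat}) (A : nat -> set (borel_rV R d)),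
    (forall k, measurable (A k)) ->
    P (\bigcap_(k in [set` J]) (xi k @^-1` A k)) =
    (\prod_(k <- J) P (xi k @^-1` A k))%E.

Definition same_distribution (xi xi' : {RV P >-> borel_rV R d}) :=
  forall A : set (borel_rV R d), measurable A ->
    P (xi @^-1` A) = P (xi' @^-1` A).

(* The constant C may depend on B: a constant common to all B would have to
   vanish, as B = set0 shows. *)
Definition tail_expansion (sigma : set (borel_rV R d) -> \bar R)
    (alpha beta : R) (xi : {RV P >-> borel_rV R d}) :=
  forall B : set (borel_rV R d), measurable B -> B `<=` sphere ->
    sigma (sphere_boundary B) = 0%E ->
    exists C : R,
      (fine (P [set w | B (direction (xi w)) /\ x < enorm (xi w)]) -
       (fine (sigma B) * x `^ (- alpha) + C * x `^ (- beta))) / x `^ (- beta)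
      @[x --> +oo] --> 0.

(* In case of a tie X may pick any maximiser, which may vary with w. *)
Definition largest_in_group (xi : nat -> {RV P >-> borel_rV R d}) (N : nat)
    (G : {set 'I_N}) (X : {RV P >-> borel_rV R d}) :=
  forall w, exists2 k : 'I_N, k \in G &
    X w = xi k w /\ forall l : 'I_N, l \in G -> enorm (xi l w) <= enorm (xi k w).

(* Convergence of the distribution functions at the continuity points of the
   limit. *)
Definition cvg_in_distribution (T : nat -> Omega -> R) (mu : set R -> \bar R) :=
  forall t : R, {for t, continuous (fun s : R => fine (mu `]-oo, s]%classic))} ->
    P [set w | T N w <= t] @[N --> \oo] --> mu `]-oo, t]%classic.

End probability.

Definition groups (N n m : nat) (G : 'I_n -> {set 'I_N}) :=
  (forall i, #|G i| = m) /\ (forall i j, i != j -> [disjoint G i & G j]%B).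

Section statistic.
Context {R : realType}.

Definition mean (n : nat) (y : 'I_n -> R) : R := (\sum_(i < n) y i) / n%:R.

Definition studentized (n : nat) (y : 'I_n -> R) (p : R) : R :=
  Num.sqrt n%:R * (mean y - p) /
  Num.sqrt (mean (fun i => y i ^+ 2) - mean y ^+ 2).

End statistic.

(* Main.v *)
Require Import Defs.
From mathcomp Require Import measurable_realfun ring lra.

(* Cut the half-line of norms into small cells and locate in them the largest norm M of the
   vectors of a group other than the k-th.  Given M, the k-th vector leads with direction in B with probability about
   P(direction in B, norm > M), which differs from sigma~(B) P(norm > M) by O(M^-beta); since
   M exceeds any y with m y^-alpha -> infinity up to a superpolynomially small probability,
   the lower bound sigma~(B) - delta with sqrt n delta -> 0 holds for the probability that the
   leader has direction in B.  The same bound for the complement of B in the sphere shows that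
   ties, and the bias, are of order delta.  Hence the number of groups with direction in B lies
   between two binomial variables with success probabilities within o(1/sqrt n) of sigma~(B).
   Binomial variables satisfy the central limit theorem uniformly in the success probability by
   Stein's method, and the studentization only perturbs the threshold. *)

(** The indicators attached to the groups need be neither independent nor identically distributed:
    norms may have atoms, and the maximiser picked at a tie may vary with the outcome in any way,
    even with the other groups. So the count itself is never treated as binomial; the two outer
    counts are built from events that depend on one group each and force a strict leader. The cells
    replace an integral against the law of M by a finite sum of probabilities of rectangles, a
    Riemann-Stieltjes sum for m times the integral of (1 - u) d(u^(m-1)), which equals 1 over
    [0, 1]. Asking M to exceed y costs about m exp(-c m y^-alpha), and the error terms cost m
    y^-beta. With y slightly below m^(1/alpha), the latter is negligible when sqrt n * m^(1 -
    beta/alpha) tends to 0: this is the balance of n and m expressed by zeta, with eps as margin.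
    Uniformity in the success probability is required because that probability moves with N. *)

Set Implicit Arguments.
Unset Strict Implicit.
Unset Printing Implicit Defensive.

Local Open Scope classical_set_scope.
Local Open Scope ring_scope.

(** * Stein's method for the binomial law *)

Section binomial_expectation.
Context {R : realType}.
Implicit Types (q : R) (F : nat -> R).

(* Expectation of [F K] for [K] binomial, by conditioning on one trial. *)
Fixpoint binE q n F : R :=
  if n is n'.+1 then q * binE q n' (F \o succn) + (1 - q) * binE q n' F else F 0.

Lemma eq_binE q n F F' : F =1 F' -> binE q n F = binE q n F'.
Proof. by move=> /funext ->. Qed.

Lemma binE_cst q n c : binE q n (fun=> c) = c.
Proof.
elim: n => //= n IH; rewrite (_ : _ \o _ = (fun=> c)) // IH; ring.
Qed.

Lemma binED q n F F' : binE q n (fun k => F k + F' k) = binE q n F + binE q n F'.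
Proof.
elim: n F F' => //= n IH F F'; rewrite IH.
rewrite (_ : _ \o _ = (fun k => (F \o succn) k + (F' \o succn) k)) // IH; ring.
Qed.

Lemma binEZ q n c F : binE q n (fun k => c * F k) = c * binE q n F.
Proof.
elim: n F => //= n IH F; rewrite IH.
rewrite (_ : _ \o _ = (fun k => c * (F \o succn) k)) // IH; ring.
Qed.

Lemma binEB q n F F' : binE q n (fun k => F k - F' k) = binE q n F - binE q n F'.
Proof.
rewrite -mulN1r -binEZ -binED; apply: eq_binE => k; ring.
Qed.

Lemma ler_binE q n F F' : 0 <= q <= 1 -> (forall k, F k <= F' k) ->
  binE q n F <= binE q n F'.
Proof.
move=> /andP[q0 q1]; elim: n F F' => //= n IH F F' FF'.
by apply: lerD; apply: ler_wpM2l; rewrite ?subr_ge0//; apply: IH => k /=.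
Qed.

Lemma normr_binE q n F : 0 <= q <= 1 ->
  `|binE q n F| <= binE q n (fun k => `|F k|).
Proof.
move=> q01; rewrite ler_norml -mulN1r -binEZ.
by rewrite !ler_binE// => k; rewrite ?mulN1r ?ler_norm// lerNl -normrN ler_norm.
Qed.

(** The extra trial is averaged inside the expectation, which reduces the inductions below to
    pointwise identities. *)
Lemma binES q n F :
  binE q n.+1 F = binE q n (fun k => q * F k.+1 + (1 - q) * F k).
Proof. by rewrite binED !binEZ. Qed.

(** Size-bias identity: given that one chosen trial succeeds, the count is one plus a binomial
    variable with one trial less. *)
Lemma binE_mulk q n F :
  binE q n.+1 (fun k => k%:R * F k) = n.+1%:R * q * binE q n (F \o succn).
Proof.
elim: n F => [|n IH] F; first by rewrite /=; ring.
rewrite binES.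
have -> : binE q n.+1 (fun k => q * (k.+1%:R * F k.+1) + (1 - q) * (k%:R * F k)) =
  q * binE q n.+1 (F \o succn) + binE q n.+1 (fun k => k%:R * (q * F k.+1 + (1 - q) * F k)).
  rewrite -binEZ -binED; apply: eq_binE => k /=; rewrite -natr1; ring.
rewrite IH (_ : binE q n (_ \o succn) = binE q n.+1 (F \o succn)) ?binES//.
by rewrite -[n.+2%:R]natr1; ring.
Qed.

Lemma binE_variance q n :
  binE q n (fun k => (k%:R - n%:R * q) ^+ 2) = n%:R * (q * (1 - q)).
Proof.
elim: n => [|n IH]; first by rewrite /=; ring.
have -> : n.+1%:R * (q * (1 - q)) = n%:R * (q * (1 - q)) + q * (1 - q).
  by rewrite -natr1; ring.
(* Averaging over one more trial adds exactly [q * (1 - q)] to the centred square, for each [k]. *)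
rewrite binES -IH -[q * (1 - q)](binE_cst q n) -binED.
by apply: eq_binE => k; rewrite -natr1; ring.
Qed.

(** Discrete counterpart of E[W g(W)] = E[g'(W)] for a normal W: the size-bias identity, minus the
    mean with one trial averaged out, leaves a difference of [F]. *)
Lemma binE_stein q n F :
  binE q n.+1 (fun k => (k%:R - n.+1%:R * q) * F k) =
  n.+1%:R * (q * (1 - q)) * binE q n (fun k => F k.+1 - F k).
Proof.
rewrite [LHS](_ : _ = binE q n.+1 (fun k => k%:R * F k - n.+1%:R * q * F k)); last first.
  by apply: eq_binE => k; ring.
rewrite !binEB binEZ binE_mulk /= (_ : F \o succn = fun k => F k.+1) //; ring.
Qed.

(** By [binE_stein] the mean of [W k * g (W k)] is that of [s] times an increment of [g] over a step
    [1 / s], hence of [g'] at an intermediate point. Only distances up to [1 / s <= 1] occur, and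
    the weight [1 + x ^+ 2] has bounded mean, so a local Lipschitz bound of quadratic growth
    suffices. The constant is [6 = 2 * (1 + 2)]: two comparisons, and a second moment at most 2. *)
Lemma stein_binomial q n (g g' : R -> R) (L : R) : 0 < q < 1 ->
  let s := Num.sqrt (n%:R * (q * (1 - q))) in
  let W k := (k%:R - n%:R * q) / s in
  1 <= s ->
  (forall x : R, is_derive x 1 g (g' x)) ->
  (forall x y, `|x - y| <= 1 -> `|g' x - g' y| <= L * (1 + x ^+ 2) * `|x - y|) ->
  `|binE q n (fun k => g' (W k) - W k * g (W k))| <= 6 * L / s.
Proof.
move=> /andP[q0 q1] s W s1 gg' g'L.
have v0 : 0 < q * (1 - q) by apply: mulr_gt0 => //; lra.
have s0 : 0 < s by lra.
case: n => [|n] in s W s1 s0 *; first by move: s0; rewrite /s mul0r sqrtr0 ltxx.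
have q01 : 0 <= q <= 1 by lra.
have L0 : 0 <= L.
  have := g'L 0 1; rewrite sub0r normrN normr1 => /(_ (lexx _)).
  by rewrite expr0n addr0 !mulr1; exact: le_trans.
have s2 : s ^+ 2 = n.+1%:R * (q * (1 - q)) by rewrite sqr_sqrtr// mulr_ge0// ltW.
have WS k : W k.+1 = W k + s^-1 by rewrite /W -[k.+1%:R]natr1; ring.
rewrite binEB.
have -> : binE q n.+1 (fun k => W k * g (W k)) = s * binE q n (fun k => g (W k.+1) - g (W k)).
  rewrite (_ : binE _ _ _ = s^-1 * binE q n.+1 (fun k => (k%:R - n.+1%:R * q) * g (W k))).
    rewrite (binE_stein q n (g \o W)) -s2 mulrA; congr (_ * _).
    by field; rewrite gt_eqF.
  by rewrite -binEZ; apply: eq_binE => k; rewrite /W; ring.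
rewrite binES -binEZ -binEB.
apply: (le_trans (normr_binE _ _ q01)) => /=.
have bnd k : `|q * g' (W k.+1) + (1 - q) * g' (W k) - s * (g (W k.+1) - g (W k))| <=
    2 * L / s * (1 + W k ^+ 2).
  rewrite WS; set x := W k.
  have sV0 : 0 < s^-1 by rewrite invr_gt0.
  have xs : x < x + s^-1 by rewrite ltrDl.
  have [z zI ->] := @MVT R g g' _ _ xs (fun y _ => gg' y)
    (derivable_within_continuous (fun y _ => @ex_derive _ _ _ _ _ _ _ (gg' y))).
  rewrite (_ : s * _ = g' z); last by field; rewrite gt_eqF.
  have sV1 : s^-1 <= 1 by rewrite invf_le1.
  have zx : `|x - z| <= s^-1.
    by move: zI; rewrite in_itv/= => /andP[? ?]; rewrite ler_norml; apply/andP; split; lra.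
  have x2 : 0 <= 1 + x ^+ 2 by have := sqr_ge0 x; lra.
  have H1 : `|g' x - g' z| <= L * (1 + x ^+ 2) * s^-1.
    apply: le_trans (g'L _ _ (le_trans zx sV1)) _.
    by apply: ler_wpM2l => //; apply: mulr_ge0.
  have H2 : `|g' x - g' (x + s^-1)| <= L * (1 + x ^+ 2) * s^-1.
    have e : `|x - (x + s^-1)| = s^-1 by rewrite opprD addrA subrr sub0r normrN gtr0_norm.
    by have := g'L x (x + s^-1); rewrite e; apply.
  rewrite [X in `|X|](_ : _ = (g' x - g' z) - q * (g' x - g' (x + s^-1))); last by ring.
  apply: (le_trans (ler_normB _ _)); rewrite normrM (gtr0_norm q0).
  have : q * `|g' x - g' (x + s^-1)| <= `|g' x - g' (x + s^-1)|.
    by rewrite ler_piMl ?normr_ge0 ?ltW.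
  move=> H3.
  by rewrite [leRHS](_ : _ = L * (1 + x ^+ 2) * s^-1 + L * (1 + x ^+ 2) * s^-1); [lra|ring].
apply: (le_trans (ler_binE n q01 bnd)).
rewrite binEZ binED binE_cst.
have -> : 6 * L / s = 2 * L / s * 3 by ring.
apply: ler_wpM2l; first by rewrite !mulr_ge0// invr_ge0 ltW.
suff : binE q n (fun k => W k ^+ 2) <= 2 by lra.
rewrite (_ : binE _ _ _ = s^-2 * binE q n (fun k => (k%:R - n.+1%:R * q) ^+ 2)); last first.
  by rewrite -binEZ; apply: eq_binE => k; rewrite /W; field; rewrite gt_eqF.
(* There are [n] trials but the centring is that of [n.+1], so the squared offset [q ^+ 2] adds to
   the variance. *)
have -> : binE q n (fun k => (k%:R - n.+1%:R * q) ^+ 2) = n%:R * (q * (1 - q)) + q ^+ 2.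
  rewrite -binE_variance -[q ^+ 2](binE_cst q n) -binED.
  rewrite [LHS](_ : _ = binE q n (fun k =>
      (k%:R - n%:R * q) ^+ 2 + q ^+ 2 - 2 * q * (k%:R - n%:R * q))).
    rewrite binEB binEZ [X in _ - _ * X](_ : _ = 0) ?mulr0 ?subr0//.
    case: (n) => [|i]; first by rewrite /= mul0r subrr.
    (* At a constant function [binE_stein] says that the centred mean vanishes. *)
    have := binE_stein q i (fun=> 1); rewrite subrr binE_cst mulr0 => <-.
    by apply: eq_binE => k; rewrite mulr1.
  by apply: eq_binE => k; rewrite -natr1; ring.
rewrite mulrC ler_pdivrMr ?exprn_gt0//.
have : 1 <= s ^+ 2 by rewrite exprn_ege1.
have : n%:R * (q * (1 - q)) <= s ^+ 2 by rewrite s2 -natr1 mulrDl mul1r lerDl ltW.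
have : q ^+ 2 <= 1 by rewrite exprn_ile1// ltW.
by lra.
Qed.

End binomial_expectation.

(** * Stein's equation for the normal law, and smoothed indicators *)

Section normal_cdf.
Context {R : realType}.
Local Notation mu := (@lebesgue_measure R).
Local Notation phi := (@normal_pdf R 0 1).

Definition normal_cdf (t : R) : R := fine (normal_prob 0 1 `]-oo, t]%classic).

Lemma normal_pdf1E (m x : R) :
  normal_pdf m 1 x = normal_peak 1 * expR (- (x - m) ^+ 2 / 2).
Proof. by rewrite normal_pdfE ?oner_neq0// /normal_fun expr1n. Qed.

(* [(s - x)^2 <= s^2 - x^2] beyond [x], so the centred density is dominated there by
   [expR (- x^2 / 2)] times the density centred at [x]. *)
Lemma Rintegral_normal_pdf_tail (A : set R) (x : R) : measurable A ->
  (forall s, A s -> 0 <= x * (s - x)) ->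
  \int[mu]_(s in A) phi s <= expR (- x ^+ 2 / 2).
Proof.
move=> mA Ax.
have iA m : mu.-integrable A (EFin \o @normal_pdf R m 1).
  exact: integrableS (integrable_normal_pdf m 1).
apply: (@le_trans _ _ (\int[mu]_(s in A) (expR (- x ^+ 2 / 2) * normal_pdf x 1 s))).
  apply: le_Rintegral => //.
    exact: (@integrableZl _ _ _ mu A mA _ (EFin \o normal_pdf x 1) (iA x)).
  move=> s /Ax xs; rewrite !normal_pdf1E mulrCA ler_wpM2l ?normal_peak_ge0//.
  rewrite -expRD ler_expR; rewrite subr0; nra.
rewrite RintegralZl// ler_piMr ?expR_ge0//.
rewrite -lee_fin /Rintegral fineK; last first.
  exact: (@integrable_fin_num _ _ _ mu A mA _ (iA x)).
rewrite -(integral_normal_pdf x 1); apply: ge0_subset_integral => //.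
  by apply/measurable_EFinP; exact: measurable_normal_pdf.
by move=> s _; rewrite lee_fin normal_pdf_ge0.
Qed.

Section stein_equation.
Variables (h : R -> R) (K : R).
Hypothesis h01 : forall x, 0 <= h x <= 1.
Hypothesis hK : forall x y, `|h x - h y| <= K * `|x - y|.

Lemma lipschitz_continuous : continuous h.
Proof.
move=> x; apply/cvgrPdist_le => /= e e0.
have K1 : 0 < 1 + `|K| by have := normr_ge0 K; lra.
near=> y.
have xy : `|x - y| <= e / (1 + `|K|).
  by near: y; apply: cvgr_dist_le => //; exact: divr_gt0.
apply: (le_trans (hK _ _)).
apply: (@le_trans _ _ ((1 + `|K|) * `|x - y|)).
  by apply: ler_wpM2r => //; have := ler_norm K; lra.
by rewrite mulrC -ler_pdivlMr.
Unshelve. all: by end_near. Qed.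

Definition normal_mean : R := \int[mu]_x (h x * phi x).

Let f x := (h x - normal_mean) * phi x.

Lemma integrable_bounded_normal_pdf (k : R -> R) C : continuous k ->
  (forall x, `|k x| <= C) ->
  mu.-integrable setT (EFin \o (fun x => k x * phi x)).
Proof.
move=> ck kC;
apply: (@le_integrable _ _ _ mu setT measurableT _ (EFin \o (fun x => C * phi x))) => //.
- apply/measurable_EFinP; apply: measurable_funM; last exact: measurable_normal_pdf.
  exact: continuous_measurable_fun.
- move=> x _ /=; rewrite lee_fin normrM (ger0_norm (normal_pdf_ge0 _ _ _)).
  apply: le_trans (ler_norm _).
  by apply: ler_wpM2r => //; exact: normal_pdf_ge0.
- exact: (@integrableZl _ _ _ mu setT measurableT C (EFin \o phi) (integrable_normal_pdf 0 1)).
Qed.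

Let ih : mu.-integrable setT (EFin \o (fun x => h x * phi x)).
Proof.
apply: (@integrable_bounded_normal_pdf _ 1); first exact: lipschitz_continuous.
by move=> x; have := h01 x; rewrite ler_norml; lra.
Qed.

Lemma Rintegral_normal_pdf : \int[mu]_x phi x = 1.
Proof. by rewrite /Rintegral integral_normal_pdf. Qed.

Lemma normal_mean01 : 0 <= normal_mean <= 1.
Proof.
apply/andP; split.
  apply: Rintegral_ge0 => x _; rewrite mulr_ge0 ?normal_pdf_ge0//.
  by have /andP[] := h01 x.
rewrite -Rintegral_normal_pdf; apply: le_Rintegral => //.
  exact: integrable_normal_pdf.
by move=> x _; rewrite ler_piMl ?normal_pdf_ge0//; have /andP[] := h01 x.
Qed.

Lemma normal_mean_dist_le1 x : `|h x - normal_mean| <= 1.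
Proof. by have := h01 x; have := normal_mean01; rewrite ler_norml; lra. Qed.

Let cf : continuous f.
Proof.
move=> x; apply: cvgM; last exact: continuous_normal_pdf.
by apply: cvgB; [exact: lipschitz_continuous|exact: cvg_cst].
Qed.

Let if_ : mu.-integrable setT (EFin \o f).
Proof.
apply: (@integrable_bounded_normal_pdf (fun x => h x - normal_mean) 1).
  by move=> x; apply: cvgB; [exact: lipschitz_continuous|exact: cvg_cst].
exact: normal_mean_dist_le1.
Qed.

Let ifA (A : set R) : measurable A -> mu.-integrable A (EFin \o f).
Proof. by move=> mA; exact: integrableS if_. Qed.

Lemma Rintegral_centered : \int[mu]_x f x = 0.
Proof.
rewrite [LHS](_ : _ = \int[mu]_x (h x * phi x - normal_mean * phi x)).
  rewrite RintegralB//; last first.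
    exact: (@integrableZl _ _ _ mu setT measurableT normal_mean (EFin \o phi)
      (integrable_normal_pdf 0 1)).
  rewrite RintegralZl//; last exact: integrable_normal_pdf.
  by rewrite Rintegral_normal_pdf mulr1 subrr.
by apply: eq_Rintegral => x _; rewrite /f; ring.
Qed.

Let Psi x : R := \int[mu]_(s in `]-oo, x]) f s.

(** As [f] has total integral 0, [Psi x] is also minus an upper tail integral. The lower tail is
    estimated for [x <= 0] and the upper one for [x > 0], where [Rintegral_normal_pdf_tail]
    applies. *)
Let Psi_le x : `|Psi x| <= expR (- x ^+ 2 / 2).
Proof.
have key (A : set R) : measurable A -> (forall s, A s -> 0 <= x * (s - x)) ->
    `|\int[mu]_(s in A) f s| <= expR (- x ^+ 2 / 2).
  move=> mA Ax; apply: le_trans (Rintegral_normal_pdf_tail mA Ax).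
  apply: (le_trans (@le_normr_Rintegral _ _ _ mu A f mA (ifA mA))).
  apply: le_Rintegral => //.
  - exact: (integrable_norm (ifA mA)).
  - exact: integrableS (integrable_normal_pdf 0 1).
  - move=> s _; rewrite normrM (ger0_norm (normal_pdf_ge0 _ _ _)).
    by rewrite ler_piMl ?normal_pdf_ge0// normal_mean_dist_le1.
have [x0|x0] := leP x 0.
  apply: key => // s; rewrite /= in_itv/= => sx; nra.
have -> : Psi x = - \int[mu]_(s in `]x, +oo[) f s.
  have := @Rintegral_itvB _ f -oo%O +oo%O x.
  rewrite set_itvNyy Rintegral_centered sub0r => <- //.
  by rewrite opprK.
rewrite normrN; apply: key => // s; rewrite /= in_itv/= andbT => xs; nra.
Qed.

(** The second factor is the reciprocal of the normal density: this is the bounded solution of g' -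
    x g = h - E h(Z), with Z standard normal. *)
Definition stein_solution x : R := Psi x * ((normal_peak 1)^-1 * expR (x ^+ 2 / 2)).

Definition stein_derivative x : R := x * stein_solution x + (h x - normal_mean).

Let peak_gt0 : 0 < normal_peak 1 :> R.
Proof. by rewrite normal_peak_gt0// oner_neq0. Qed.

Lemma stein_solution_le x : `|stein_solution x| <= (normal_peak 1)^-1.
Proof.
have c0 : 0 < (normal_peak 1)^-1 * expR (x ^+ 2 / 2).
  by apply: mulr_gt0; [rewrite invr_gt0; exact: peak_gt0|exact: expR_gt0].
rewrite normrM (gtr0_norm c0).
apply: (le_trans (ler_wpM2r (ltW c0) (Psi_le x))).
by rewrite mulrCA mulNr -expRD addNr expR0 mulr1.
Qed.

Lemma is_derive_stein (x : R) : is_derive x 1 stein_solution (stein_derivative x).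
Proof.
have dPsi : is_derive x 1 Psi (f x).
  have [] := @continuous_FTC1 _ f -oo%O x (x + 1) _ _ (ltNyr _) (@cf x).
  - by rewrite ltrDl.
  - exact: ifA.
  - by move=> d1 d2; exact: (DeriveDef d1 (etrans (esym (derive1E _ _)) d2)).
have dE : is_derive x 1 (fun x : R => (normal_peak 1)^-1 * expR (x ^+ 2 / 2))
    (x * ((normal_peak 1)^-1 * expR (x ^+ 2 / 2))).
  apply: is_derive_eq.
  by rewrite /GRing.scale/=; field; rewrite gt_eqF// peak_gt0.
apply: is_derive_eq.
rewrite /stein_derivative /stein_solution /f /GRing.scale/=.
rewrite normal_pdf1E subr0 mulNr expRN.
by field; rewrite !gt_eqF ?expR_gt0// peak_gt0.
Qed.

Lemma stein_derivativeE x :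
  stein_derivative x - x * stein_solution x = h x - normal_mean.
Proof. by rewrite /stein_derivative addrAC subrr add0r. Qed.

(** The difference splits into [x] times a difference of solutions, [x - y] times a solution, and a
    difference of [h]. The mean value theorem gives the solution a Lipschitz constant of order
    [1 + |x|] near [x]; multiplied by [x] it yields the quadratic weight allowed in
    [stein_binomial]. *)
Lemma stein_derivative_lipschitz (x y : R) : `|x - y| <= 1 ->
  `|stein_derivative x - stein_derivative y| <=
  (1 + 3 * (normal_peak 1)^-1 + `|K|) * (1 + x ^+ 2) * `|x - y|.
Proof.
move=> xy; set c : R := (normal_peak 1)^-1.
have c0 : 0 <= c by rewrite invr_ge0 ltW.
have dle z : `|z - x| <= 1 -> `|stein_derivative z| <= (`|x| + 1) * c + 1.
  move=> zx; apply: (le_trans (ler_normD _ _)).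
  apply: lerD; last exact: normal_mean_dist_le1.
  rewrite normrM; apply: ler_pM => //; last exact: stein_solution_le.
  by have := ler_normD x (z - x); rewrite subrKC; lra.
have key a b : a <= b -> `|a - x| <= 1 -> `|b - x| <= 1 ->
    `|stein_solution b - stein_solution a| <= ((`|x| + 1) * c + 1) * (b - a).
  rewrite le_eqVlt => /orP[/eqP <-|ab] ax bx; first by rewrite !subrr normr0 mulr0.
  have [z zI ->] := @MVT R stein_solution stein_derivative _ _ ab
    (fun y _ => is_derive_stein y)
    (derivable_within_continuous (fun y _ => @ex_derive _ _ _ _ _ _ _ (is_derive_stein y))).
  rewrite normrM [X in _ * X]gtr0_norm ?subr_gt0//.
  apply: ler_wpM2r; first by rewrite subr_ge0 ltW.
  apply: dle; move: zI ax bx; rewrite in_itv/= !ler_norml.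
  by move=> /andP[? ?] /andP[? ?] /andP[? ?]; apply/andP; split; lra.
have gxy : `|stein_solution x - stein_solution y| <= ((`|x| + 1) * c + 1) * `|x - y|.
  have xx : `|x - x| <= 1 by rewrite subrr normr0.
  have yx : `|y - x| <= 1 by rewrite distrC.
  have [xley|yltx] := leP x y.
    by rewrite distrC [X in _ <= _ * X]distrC [X in _ <= _ * X]ger0_norm ?subr_ge0//; exact: key.
  by rewrite [X in _ <= _ * X]gtr0_norm ?subr_gt0//; exact: key (ltW yltx) yx xx.
rewrite (_ : _ - _ = x * (stein_solution x - stein_solution y) +
  (x - y) * stein_solution y + (h x - h y)); last by rewrite /stein_derivative; ring.
have := ler_normD (x * (stein_solution x - stein_solution y) +
  (x - y) * stein_solution y) (h x - h y).
have := ler_normD (x * (stein_solution x - stein_solution y))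
  ((x - y) * stein_solution y).
rewrite (normrM x) (normrM (x - y)).
have H1 : `|x| * `|stein_solution x - stein_solution y| <=
    `|x| * (((`|x| + 1) * c + 1) * `|x - y|) by exact: ler_wpM2l.
have H2 : `|x - y| * `|stein_solution y| <= `|x - y| * c.
  by apply: ler_wpM2l => //; exact: stein_solution_le.
have H3 : `|h x - h y| <= `|K| * `|x - y|.
  by apply: (le_trans (hK _ _)); rewrite ler_wpM2r// ler_norm.
have H4 : `|x| * (((`|x| + 1) * c + 1) * `|x - y|) + `|x - y| * c + `|K| * `|x - y| <=
    (1 + 3 * c + `|K|) * (1 + x ^+ 2) * `|x - y|.
  rewrite [leLHS](_ : _ = (`|x| * ((`|x| + 1) * c + 1) + c + `|K|) * `|x - y|); last by ring.
  apply: ler_wpM2r => //.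
  rewrite -(real_normK (num_real x)).
  have x0 := normr_ge0 x; have k0 := normr_ge0 K.
  have xx : `|x| <= 1 + `|x| ^+ 2 by nra.
  have ? : 0 <= (1 + `|x| ^+ 2 - `|x|) * c by rewrite mulr_ge0// subr_ge0.
  have ? : 0 <= `|K| * `|x| ^+ 2 by rewrite mulr_ge0// sqr_ge0.
  have ? : 0 <= c * `|x| ^+ 2 by rewrite mulr_ge0// sqr_ge0.
  lra.
lra.
Qed.

End stein_equation.

(** Stein's equation wants a Lipschitz test function; this one lies between the indicators of []-oo,
    t]] and []-oo, t + e]]. *)
Definition ramp (t e x : R) : R := Num.max 0 (Num.min 1 ((t - x) / e + 1)).

Section ramp.
Variables (t e : R).
Hypothesis e0 : 0 < e.

Lemma ramp01 x : 0 <= ramp t e x <= 1.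
Proof. by rewrite /ramp le_max lexx/= ge_max ler01 ge_min lexx. Qed.

Lemma ramp_lipschitz x y : `|ramp t e x - ramp t e y| <= e^-1 * `|x - y|.
Proof.
have : `|(t - x) / e + 1 - ((t - y) / e + 1)| <= e^-1 * `|x - y|.
  rewrite (_ : _ - _ = e^-1 * (y - x)); last by ring.
  by rewrite normrM gtr0_norm ?invr_gt0// distrC.
rewrite /ramp; move: ((t - x) / e + 1) ((t - y) / e + 1) (e^-1 * `|x - y|) => a b c.
have max_min (d : R) : Num.max 0 (Num.min 1 d) = if d <= 0 then 0 else if 1 <= d then 1 else d.
  by case: (leP 1 d) => d1; case: (leP d 0) => d0 //; [lra|rewrite max_r// ler01].
rewrite !max_min !ler_norml => /andP[ab ba].
by case: (leP a 0) => a0; case: (leP b 0) => b0; case: (leP 1 a) => a1;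
  case: (leP 1 b) => b1; apply/andP; split; lra.
Qed.

Lemma ramp_ge x : (x <= t)%R%:R <= ramp t e x.
Proof.
case: (leP x t) => xt; last by have /andP[] := ramp01 x.
by rewrite /ramp le_max le_min lexx/= lerDr divr_ge0 ?orbT// ?subr_ge0// ltW.
Qed.

Lemma ramp_le x : ramp t e x <= (x <= t + e)%R%:R.
Proof.
case: (leP x (t + e)) => xt; first by have /andP[] := ramp01 x.
rewrite /ramp ge_max lexx/= ge_min; apply/orP; right.
rewrite -lerBrDr sub0r ler_pdivrMr//; lra.
Qed.

Let cdfE (u : R) : normal_cdf u = \int[mu]_x ((x <= u)%R%:R * phi x).
Proof.
rewrite /normal_cdf /normal_prob.
rewrite -[LHS]/(\int[mu]_(x in `]-oo, u]) phi x).
rewrite Rintegral_mkcond; apply: eq_Rintegral => x _.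
rewrite patchE; case: ifPn => [|].
  by rewrite inE/= in_itv/= => ->; rewrite mul1r.
by rewrite notin_setE/= in_itv/= => /negP/negbTE ->; rewrite mul0r.
Qed.

Let ile (u : R) : mu.-integrable setT (EFin \o (fun x => (x <= u)%R%:R * phi x)).
Proof.
apply: (@le_integrable _ _ _ mu setT measurableT _ (EFin \o phi)) => //.
- apply/measurable_EFinP; apply: measurable_funM; last exact: measurable_normal_pdf.
  rewrite (_ : (fun _ => _) = \1_`]-oo, u]); first exact: measurable_indic.
  apply/funext => x; rewrite indicE; congr (nat_of_bool _)%:R.
  by rewrite mem_setE in_itv.
- move=> x _ /=; rewrite lee_fin normrM (ger0_norm (normal_pdf_ge0 _ _ _)).
  by rewrite ler_piMl ?normal_pdf_ge0//; case: (x <= u); rewrite ?normr1 ?normr0.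
- exact: integrable_normal_pdf.
Qed.

Let iramp : mu.-integrable setT (EFin \o (fun x => ramp t e x * phi x)).
Proof.
apply: (@integrable_bounded_normal_pdf _ 1).
  exact: lipschitz_continuous ramp_lipschitz.
by move=> x; have := ramp01 x; rewrite ler_norml; lra.
Qed.

Lemma normal_mean_ramp :
  normal_cdf t <= normal_mean (ramp t e) <= normal_cdf (t + e).
Proof.
by rewrite !cdfE; apply/andP; split; apply: le_Rintegral => // x _;
  rewrite ler_wpM2r ?normal_pdf_ge0// ?ramp_ge ?ramp_le.
Qed.

End ramp.

(** The witness [L] comes from the Lipschitz constant [e^-1] of the ramps and does not involve [n]
    or [q]; the price of smoothing is a shift of the argument by [e]. *)
Lemma binomial_cdf (t e : R) : 0 < e -> exists L : R, forall n q,
  let s := Num.sqrt (n%:R * (q * (1 - q))) in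
  let F u := binE q n (fun k => ((k%:R - n%:R * q) / s <= u)%R%:R) in
  0 < q < 1 -> 1 <= s ->
  F t <= normal_cdf (t + e) + L / s /\ normal_cdf (t - e) - L / s <= F t.
Proof.
move=> e0; exists (6 * (1 + 3 * (normal_peak 1)^-1 + `|e^-1|)) => n q s F q01 s1.
have q01' : 0 <= q <= 1 by move: q01 => /andP[/ltW -> /ltW ->].
pose W (k : nat) := (k%:R - n%:R * q) / s.
have key u : `|binE q n (ramp u e \o W) - normal_mean (ramp u e)| <=
    6 * (1 + 3 * (normal_peak 1)^-1 + `|e^-1|) / s.
  have r01 := ramp01 u e; have rL := ramp_lipschitz u e0.
  rewrite -[normal_mean _](binE_cst q n) -binEB.
  rewrite (_ : binE _ _ _ = binE q n (fun k => stein_derivative (ramp u e) (W k) -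
     W k * stein_solution (ramp u e) (W k))).
    apply: (stein_binomial q01 s1).
      by move=> x; exact: is_derive_stein rL x.
    by move=> x y; exact: stein_derivative_lipschitz.
  by apply: eq_binE => k; rewrite stein_derivativeE.
have /andP[t1 t2] := normal_mean_ramp t e0.
have /andP[t3 t4] := normal_mean_ramp (t - e) e0.
split.
  apply: (@le_trans _ _ (binE q n (ramp t e \o W))).
    by apply: ler_binE => // k; exact: ramp_ge.
  by have := key t; rewrite ler_norml; lra.
apply: (@le_trans _ _ (binE q n (ramp (t - e) e \o W))).
  by have := key (t - e); rewrite ler_norml; lra.
by apply: ler_binE => // k; rewrite -{2}(subrK e t); exact: ramp_le.
Qed.

End normal_cdf.

(** * Independence of disjoint groups *)

Lemma content_fin_bigcup d (T : ringOfSetsType d) (R : realFieldType)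
    (mu : {content set T -> \bar R}) (I : finType) (p : pred I) (F : I -> set T) :
  (forall i, p i -> measurable (F i)) -> trivIset [set i | p i] F ->
  mu (\bigcup_(i in [set i | p i]) F i) = (\sum_(i | p i) mu (F i))%E.
Proof.
move=> mF tF; rewrite measure_fin_bigcup//; last first.
  exact: finite_finset.
rewrite -[RHS]big_filter [RHS]fsbig_seq; last exact: (filter_uniq _ (index_enum_uniq _)).
rewrite (_ : [set` _] = [set i | p i])//.
by apply/seteqP; split => i /=; rewrite mem_filter mem_index_enum andbT.
Qed.

(** Stated over an arbitrary measurable space, so that it serves for [Omega] as well as for the
    sigma-algebra generated by some of the vectors. *)
Lemma measurable_count d (T : measurableType d) (L : eqType) (s : seq L)
    (E : L -> set T) (Q : pred nat) :
  {in s, forall i, measurable (E i)} ->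
  measurable [set w | Q (\sum_(i <- s) (w \in E i))%N].
Proof.
elim: s Q => [|i s IH] Q mE.
  case: (boolP (Q 0%N)) => Q0.
    rewrite (_ : [set _ | _] = setT)//.
    by apply/seteqP; split => // w _ /=; rewrite big_nil.
  rewrite (_ : [set _ | _] = set0)//.
  by apply/seteqP; split => // w /=; rewrite big_nil; exact/negP.
have mi : measurable (E i) by apply: mE; rewrite mem_head.
have ms (Q' : pred nat) : measurable [set w | Q' (\sum_(j <- s) (w \in E j))%N].
  by apply: IH => j js; apply: mE; rewrite inE js orbT.
rewrite (_ : [set _ | _] = (E i `&` [set w | Q (\sum_(j <- s) (w \in E j)).+1]) `|`
                           (~` E i `&` [set w | Q (\sum_(j <- s) (w \in E j))%N])).
  apply: measurableU; apply: measurableI => //; last exact: measurableC.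
  exact: (ms (fun k => Q k.+1)).
apply/seteqP; split => w /=; rewrite big_cons.
  have [/set_mem Ew|/negP wE] := boolP (w \in E i); first by left.
  by right; split => // Ew; apply: wE; exact: mem_set.
by move=> [[Ew]|[nEw]]; rewrite ?(mem_set Ew) ?(memNset nEw).
Qed.

Lemma finset_bigcup_sup (I : finType) (L : eqType) (s : seq L) (G : L -> {set I}) i :
  i \in s -> G i \subset (\bigcup_(j <- s) G j)%SET.
Proof.
move=> si; apply/fintype.subsetP => x Gx; by rewrite (big_rem i)//= inE Gx.
Qed.

Section independence.
Context {R : realType} {dO dT : measure_display} {Omega : measurableType dO}
  {T : measurableType dT} (P : probability Omega R)
  (I : finType) (X : I -> {mfun Omega >-> T}).
Implicit Types (J K : {set I}) (A : I -> set T).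

Definition cylinder J A : set Omega := [set w | forall k, k \in J -> A k (X k w)].

Definition cylinders J : set (set Omega) :=
  [set E | exists2 A, (forall k, measurable (A k)) & E = cylinder J A].

(** Generating by whole cylinders, a pi-system, rather than by single preimages lets uniqueness of
    measures apply directly. *)
Definition determined_by J : set (set Omega) := <<s cylinders J >>.

Lemma measurable_cylinder J A : (forall k, measurable (A k)) ->
  measurable (cylinder J A).
Proof.
move=> mA; rewrite (_ : cylinder J A = \bigcap_(k in [set k | k \in J]) (X k @^-1` A k)).
  apply: fin_bigcap_measurable; first exact: finite_finset.
  by move=> k _; exact: measurable_funPTI.
by apply/seteqP; split.
Qed.

Lemma cylinders_measurable J : cylinders J `<=` measurable.
Proof. by move=> _ [A mA ->]; exact: measurable_cylinder. Qed.

Lemma cylindersT J : cylinders J setT.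
Proof. by exists (fun=> setT) => //; apply/seteqP; split. Qed.

Lemma cylinders_setI_closed J : setI_closed (cylinders J).
Proof.
move=> _ _ [A mA ->] [B mB ->]; exists (fun k => A k `&` B k).
  by move=> k; exact: measurableI.
apply/seteqP; split => w /=; first by move=> [a b] k kJ; split; [exact: a|exact: b].
by move=> ab; split=> k /ab[].
Qed.

Lemma determined_by_measurable J E : determined_by J E -> measurable E.
Proof.
apply: smallest_sub => //; last exact: cylinders_measurable.
exact: sigma_algebra_measurable.
Qed.

Lemma determined_by_cylinder J A : (forall k, measurable (A k)) ->
  determined_by J (cylinder J A).
Proof. by move=> mA; apply: sub_sigma_algebra; exists A. Qed.

Lemma determined_by_sub J K : J \subset K -> determined_by J `<=` determined_by K.
Proof.
move=> /fintype.subsetP JK; apply: sub_sigma_algebra2 => _ [A mA ->].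
exists (fun k => if k \in J then A k else setT); first by move=> k; case: ifP.
apply/seteqP; split => w wA k; first by move=> _; case: ifPn => // /wA.
by move=> kJ; have := wA k (JK _ kJ); rewrite kJ.
Qed.

Lemma determined_by_preimage J k (A : set T) : measurable A -> k \in J ->
  determined_by J (X k @^-1` A).
Proof.
move=> mA kJ; apply: (@determined_by_sub [set k]%SET); first by rewrite finset.sub1set.
rewrite (_ : _ @^-1` _ = cylinder [set k]%SET (fun=> A)); first exact: determined_by_cylinder.
apply/seteqP; split => w /= Aw; first by move=> _ /set1P ->.
by apply: Aw; rewrite inE.
Qed.

Lemma determined_byI J E F :
  determined_by J E -> determined_by J F -> determined_by J (E `&` F).
Proof. exact: (@measurableI _ (g_sigma_algebraType (cylinders J))). Qed.

Lemma determined_byD J E F :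
  determined_by J E -> determined_by J F -> determined_by J (E `\` F).
Proof. exact: (@measurableD _ (g_sigma_algebraType (cylinders J))). Qed.

Lemma determined_byC J E : determined_by J E -> determined_by J (~` E).
Proof. exact: (@measurableC _ (g_sigma_algebraType (cylinders J))). Qed.

Lemma determined_by_bigcup (L : finType) (p : pred L) J (E : L -> set Omega) :
  (forall l, p l -> determined_by J (E l)) ->
  determined_by J (\bigcup_(l in [set l | p l]) E l).
Proof.
move=> EJ; apply: (@fin_bigcup_measurable _ (g_sigma_algebraType (cylinders J))) => //.
Qed.

Hypothesis indep : forall J A, (forall k, measurable (A k)) ->
  P (cylinder J A) = (\prod_(k in J) P (X k @^-1` A k))%E.

(** For a fixed event [G], the restriction of [P] to [G] and the multiple [P G] of [P] agree on a
    generated sigma-algebra once they agree on its cylinders; this is [step]. Used in each argument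
    in turn, it leaves two cylinders over disjoint index sets, which intersect in a cylinder over
    the union. *)
Lemma determined_by_indep J K E F : [disjoint J & K]%B ->
  determined_by J E -> determined_by K F -> (P (E `&` F) = P E * P F)%E.
Proof.
move=> JK JE KF.
have step (G : set Omega) L : measurable G ->
    (forall C, cylinders L C -> (P (C `&` G) = P C * P G)%E) ->
    forall C, determined_by L C -> (P (C `&` G) = P C * P G)%E.
  move=> mG cG C LC.
  have PG : 0 <= fine (P G) by rewrite fine_ge0.
  have scaleE (A : set Omega) : (mscale (NngNum PG) P A = P A * P G)%E.
    by rewrite /mscale/= fineK ?fin_num_measure// muleC.
  rewrite -scaleE.
  apply: (@g_sigma_algebra_measure_unique _ R Omega (cylinders L)
    (@cylinders_measurable L) (fun=> setT) (fun=> cylindersT L) _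
    (mrestr P mG) (mscale (NngNum PG) P) (@cylinders_setI_closed L)) => //.
  - by apply/seteqP; split => // w _; exists 0%N.
  - by move=> A LA; exact: (etrans (cG A LA) (esym (scaleE A))).
  - by move=> _; rewrite ltey_eq fin_num_measure.
have mF := determined_by_measurable KF.
apply: (step F J mF) => // _ [A mA ->]; rewrite setIC muleC.
apply: (step _ K) => //; first exact: measurable_cylinder.
move=> _ [B mB ->].
rewrite (_ : _ `&` _ = cylinder (J :|: K) (fun k => if k \in J then A k else B k)).
  rewrite !indep//; last by move=> k; case: ifP.
  rewrite muleC [X in (X = _)%E](@big_setID _ _ _ _ _ J)/=; congr (_ * _)%E.
    rewrite finset.setUK; by apply: eq_bigr => k kJ; rewrite kJ.
  rewrite finset.setDUl finset.setDv finset.set0U.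
  have -> : (K :\: J = K)%SET.
    by apply/eqP; rewrite finset.eqEsubset finset.subsetDl/= finset.subsetD fintype.subxx
      disjoint_sym JK.
  apply: eq_bigr => k kK; rewrite ifF//; apply/negbTE.
  by apply/negP => kJ; move/pred0P: JK => /(_ k)/=; rewrite kJ kK.
apply/seteqP; split => w /=.
  move=> [Bw Aw] k; rewrite inE; case: ifP => [kJ _|_]; first exact: Aw.
  by move=> /=; exact: Bw.
move=> H; split=> k kJ; last by have := H k; rewrite inE kJ; apply.
have := H k; rewrite inE kJ orbT ifF; first by apply.
by apply/negbTE/negP => kJ'; move/pred0P: JK => /(_ k)/=; rewrite kJ kJ'.
Qed.

(** Split on the event of the first group: the remaining count is determined by the union of the
    other groups, disjoint from the first, so independence reproduces the recursion of [binE]. *)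
Lemma binomial_count (L : eqType) (r : seq L) (G : L -> {set I}) (E : L -> set Omega)
    (q : R) (Q : pred nat) :
  uniq r -> {in r &, forall i j, i != j -> [disjoint G i & G j]%B} ->
  {in r, forall i, determined_by (G i) (E i)} ->
  {in r, forall i, P (E i) = q%:E} ->
  P [set w | Q (\sum_(i <- r) (w \in E i))%N] =
    (binE q (size r) (fun k => (Q k)%:R))%:E.
Proof.
pose count s w := (\sum_(i <- s) (w \in E i))%N.
have dcount s (Q' : pred nat) : {in s, forall i, determined_by (G i) (E i)} ->
    determined_by (\bigcup_(i <- s) G i) [set w | Q' (count s w)].
  move=> ds; apply: (@measurable_count _ (g_sigma_algebraType (cylinders _)) _ s E) => i si.
  exact: (determined_by_sub (@finset_bigcup_sup _ _ s G i si) (ds i si)).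
elim: r Q => [|i r IH] Q /=.
  move=> _ _ _ _; case: (boolP (Q 0%N)) => Q0.
    rewrite (_ : [set _ | _] = setT) ?probability_setT//.
    by apply/seteqP; split => // w _ /=; rewrite big_nil.
  rewrite (_ : [set _ | _] = set0) ?measure0//.
  by apply/seteqP; split => // w /=; rewrite big_nil; exact/negP.
move=> /andP[ir ur] dG dE PE.
have dG' : {in r &, forall i j, i != j -> [disjoint G i & G j]%B}.
  by move=> j k jr kr; apply: dG; rewrite inE ?jr ?kr orbT.
have dE' : {in r, forall i, determined_by (G i) (E i)}.
  by move=> j jr; apply: dE; rewrite inE jr orbT.
have PE' : {in r, forall i, P (E i) = q%:E}.
  by move=> j jr; apply: PE; rewrite inE jr orbT.
have dEi : determined_by (G i) (E i) by apply: dE; rewrite mem_head.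
have mEi := determined_by_measurable dEi.
have mcount (Q' : pred nat) : measurable [set w | Q' (count r w)].
  exact: determined_by_measurable (dcount r Q' dE').
have GiG : [disjoint G i & \bigcup_(j <- r) G j]%B.
  rewrite disjoint_sym big_seq.
  apply: (big_ind (fun U : {set I} => [disjoint U & G i]%B)).
  - by rewrite -setI_eq0 finset.set0I.
  - by move=> U V; rewrite -!setI_eq0 finset.setIUl finset.setU_eq0 => -> ->.
  - by move=> j jr; apply: dG; rewrite ?inE ?jr ?eqxx ?orbT//; apply: contraNneq ir => <-.
rewrite (_ : [set _ | _] = (E i `&` [set w | Q (count r w).+1]) `|`
                           (~` E i `&` [set w | Q (count r w)])); last first.
  apply/seteqP; split => w /=; rewrite /count big_cons.
    have [/set_mem Ew|/negP wE] := boolP (w \in E i); first by left.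
    by right; split => // Ew; apply: wE; exact: mem_set.
  by move=> [[Ew]|[nEw]]; rewrite ?(mem_set Ew) ?(memNset nEw).
rewrite measureU//; first last.
- by apply/seteqP; split => // w [[? ?] []].
- by apply: measurableI => //; exact: measurableC.
- by apply: measurableI => //; exact: (mcount (fun k => Q k.+1)).
have PS : P (E i `&` [set w | Q (count r w).+1]) = (P (E i) * P [set w | Q (count r w).+1])%E.
  exact: (determined_by_indep GiG dEi (dcount r (fun k => Q k.+1) dE')).
have PC : P (~` E i `&` [set w | Q (count r w)]) = (P (~` E i) * P [set w | Q (count r w)])%E.
  exact: (determined_by_indep GiG (determined_byC dEi) (dcount r Q dE')).
rewrite (_ : _ + _ = P (E i `&` [set w | Q (count r w).+1]) +
    P (~` E i `&` [set w | Q (count r w)]))%E// PS PC probability_setC// PE ?mem_head//.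
have -> : P [set w | Q (count r w).+1] = _ := IH (fun k => Q k.+1) ur dG' dE' PE'.
by rewrite (IH Q ur dG' dE' PE').
Qed.

End independence.

(** * Leaders of a group *)

Section largest.
Context {R : realType} {dO dT : measure_display} {Omega : measurableType dO}
  {T : measurableType dT} (P : probability Omega R)
  (I : finType) (X : I -> {mfun Omega >-> T}) (X0 : {mfun Omega >-> T}).
Variables (rho : T -> R) (x : nat -> R) (J : nat).
Hypothesis mrho : measurable_fun setT rho.
Hypothesis x_nd : nondecreasing_seq x.
Hypothesis X_distr : forall k A, measurable A -> P (X k @^-1` A) = P (X0 @^-1` A).
Hypothesis indep : forall (K : {set I}) A, (forall k, measurable (A k)) ->
  P (cylinder X K A) = (\prod_(k in K) P (X k @^-1` A k))%E.
Implicit Types (D : set T) (G : {set I}).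

Definition above D j : set T := [set v | D v /\ x j < rho v].
Definition below j : set T := [set v | rho v <= x j].

Lemma measurable_above D j : measurable D -> measurable (above D j).
Proof.
move=> mD; apply: measurableI => //.
rewrite [X in measurable X](_ : _ = setT `&` rho @^-1` `]x j, +oo[).
  exact: mrho.
by rewrite setTI; apply/seteqP; split => v /=; rewrite in_itv/= andbT.
Qed.

Lemma measurable_below j : measurable (below j).
Proof.
rewrite [X in measurable X](_ : _ = setT `&` rho @^-1` `]-oo, x j]).
  exact: mrho.
by rewrite setTI; apply/seteqP; split => v /=; rewrite in_itv.
Qed.

(* Rectangles approximating the event that [X k] is the strict maximiser over [G] and lies in
   [D]: the cell of the largest of the other values makes their probability explicit. *)
Definition leader D G (k : I) (j : nat) : set Omega :=
  X k @^-1` above D j.+1 `&`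
  (cylinder X (G :\ k)%SET (fun=> below j.+1) `\`
   cylinder X (G :\ k)%SET (fun=> below j)).

(** An inner approximation: outcomes where the two largest values share a cell, or where the second
    largest lies outside []x 0, x J]], are given up, since only a lower bound on the probability is
    sought. *)
Definition led_by D G : set Omega :=
  \bigcup_(kj in [set kj : I * 'I_J | kj.1 \in G]) leader D G kj.1 kj.2.

Lemma determined_by_led_by D G : measurable D -> determined_by X G (led_by D G).
Proof.
move=> mD; apply: determined_by_bigcup => -[k j] /= kG.
apply: determined_byI.
  by apply: determined_by_preimage => //; exact: measurable_above.
have GkG : (G :\ k)%SET \subset G by rewrite finset.subsetDl.
by apply: determined_byD; apply: (determined_by_sub GkG);
  apply: determined_by_cylinder => _; exact: measurable_below.
Qed.

Lemma leader_max D G k j w l : leader D G k j w -> l \in G -> l != k ->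
  rho (X l w) < rho (X k w).
Proof.
move=> [/= [_ xk] [lx _]] lG lk; apply: le_lt_trans xk.
by apply: lx; rewrite !inE lk.
Qed.

(** The leader beats every other member strictly, so any maximiser is the leader, whatever the rule
    for ties. *)
Lemma led_by_max D G w k : led_by D G w -> k \in G ->
  (forall l, l \in G -> rho (X l w) <= rho (X k w)) -> D (X k w).
Proof.
move=> [[k' j] /= k'G ld] kG kmax.
have [->|kk'] := eqVneq k k'; first by case: ld => -[].
by have := kmax _ k'G; rewrite leNgt (leader_max ld kG kk').
Qed.

Lemma led_by_disjoint D D' G : D `&` D' = set0 -> led_by D G `&` led_by D' G = set0.
Proof.
move=> DD'; apply/seteqP; split => // w [Dw [[k j] /= kG ld]].
suff : (D `&` D') (X k w) by rewrite DD'.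
split; last by case: ld => -[].
apply: (led_by_max Dw) => // l lG; have [->//|lk] := eqVneq l k.
exact/ltW/(leader_max ld).
Qed.

Let b D j : R := fine (P (X0 @^-1` above D j)).
Let g j : R := fine (P (X0 @^-1` below j)).

Lemma prob_leader_cylinder D G k i j : measurable D -> k \in G ->
  P (X k @^-1` above D i `&` cylinder X (G :\ k)%SET (fun=> below j)) =
  (b D i * g j ^+ #|G|.-1)%:E.
Proof.
move=> mD kG.
rewrite [X in P X](_ : _ = cylinder X G (fun l => if l == k then above D i else below j)).
  rewrite indep; last first.
    by move=> l; case: ifP => _; [exact: measurable_above|exact: measurable_below].
  rewrite (big_setD1 k)//= eqxx X_distr; last exact: measurable_above.
  rewrite EFinM fineK ?fin_num_measure//; last exact: measurable_funPTI (measurable_above _ mD).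
  congr (_ * _)%E.
  rewrite (eq_bigr (fun=> (g j)%:E)); last first.
    move=> l; rewrite !inE => /andP[/negbTE -> lG].
    rewrite X_distr; last exact: measurable_below.
    by rewrite fineK// fin_num_measure//; exact: measurable_funPTI (measurable_below _).
  by rewrite prodEFin prodr_const (cardsD1 k G) kG.
apply/seteqP; split => w /=.
  move=> [aw bw] l lG; case: eqVneq => [->//|lk]; by apply: bw; rewrite !inE lk.
move=> H; split; first by have := H k kG; rewrite eqxx.
by move=> l; rewrite !inE => /andP[lk lG]; have := H l lG; rewrite (negbTE lk).
Qed.

Lemma below_nd : {homo below : i j / (i <= j)%N >-> i `<=` j}.
Proof. by move=> i j /x_nd ij v /= /le_trans; apply. Qed.

(** The two cylinders in [leader] are nested, so the cell contributes a difference of powers; the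
    exponent counts the other members of [G]. *)
Lemma prob_leader D G k j : measurable D -> k \in G ->
  P (leader D G k j) =
  (b D j.+1 * (g j.+1 ^+ #|G|.-1 - g j ^+ #|G|.-1))%:E.
Proof.
move=> mD kG; rewrite /leader setIDA measureD//=.
- rewrite [X in (_ - P X)%E](_ : _ = X k @^-1` above D j.+1 `&`
      cylinder X (G :\ k)%SET (fun=> below j)); last first.
    apply/seteqP; split => w /=; first by move=> [[]].
    move=> [aw bw]; split => //; split => // l lG.
    exact: below_nd (leqnSn j) _ (bw l lG).
  by rewrite !prob_leader_cylinder// -EFinB mulrBr.
- apply: measurableI; first exact: measurable_funPTI (measurable_above _ mD).
  by apply: measurable_cylinder => _; exact: measurable_below.
- by apply: measurable_cylinder => _; exact: measurable_below.
- by rewrite ltey_eq fin_num_measure//; apply: measurableI;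
    [exact: measurable_funPTI (measurable_above _ mD)|
     apply: measurable_cylinder => _; exact: measurable_below].
Qed.

(** Strictness fixes the leader, and the cell of the largest of the other values then fixes [j]. *)
Lemma trivIset_leader D G : trivIset [set kj : I * 'I_J | kj.1 \in G]
  (fun kj => leader D G kj.1 kj.2).
Proof.
move=> [k i] [l j] /= kG lG [w [/= wk wl]].
have [kl|kl] := eqVneq k l; last first.
  by have := lt_trans (leader_max wk lG _) (leader_max wl kG kl);
    rewrite eq_sym ltxx => /(_ kl).
move: wk; rewrite kl => wk {k kl kG}.
case: wk wl => _ [wi nwi] [_ [wj nwj]].
have key (a c : 'I_J) : (a < c)%N -> cylinder X (G :\ l)%SET (fun=> below a.+1) w ->
    cylinder X (G :\ l)%SET (fun=> below c) w.
  by move=> ac wa h hG; exact: below_nd ac _ (wa h hG).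
case: (ltngtP i j) => [ij|ji|/ord_inj -> //].
- by exfalso; apply: nwj; exact: key wi.
- by exfalso; apply: nwi; exact: key wj.
Qed.

Lemma prob_led_by D G : measurable D ->
  P (led_by D G) =
  (#|G|%:R * \sum_(j < J) b D j.+1 * (g j.+1 ^+ #|G|.-1 - g j ^+ #|G|.-1))%:E.
Proof.
move=> mD; rewrite /led_by content_fin_bigcup; last exact: trivIset_leader.
- rewrite (eq_bigr (fun kj : I * 'I_J =>
    (b D kj.2.+1 * (g kj.2.+1 ^+ #|G|.-1 - g kj.2 ^+ #|G|.-1))%:E)); last first.
    by move=> [k j] /= kG; rewrite prob_leader.
  rewrite sumEFin; congr EFin.
  rewrite mulr_natl -sumr_const pair_big /=.
  by apply: eq_bigl => -[k j]; rewrite andbT.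
- move=> [k j] /= kG; apply: measurableI.
    exact: measurable_funPTI (measurable_above _ mD).
  by apply: measurableD; apply: measurable_cylinder => _; exact: measurable_below.
Qed.

End largest.

(** * Probability of a leader in a given direction *)

Section telescoping.
Context {R : realType}.
Implicit Types (g b : nat -> R) (M J : nat).

(** The graph of the convex function [u ^+ M.+1] lies above its tangent at [v]. *)
Lemma young_expr (u v : R) M : 0 <= u -> 0 <= v ->
  M.+1%:R * u * v ^+ M <= M%:R * v ^+ M.+1 + u ^+ M.+1.
Proof.
move=> u0 v0; elim: M => [|M IH]; first by rewrite expr0 mul0r add0r mul1r mulr1.
have H : 0 <= (v - u) * (v ^+ M.+1 - u ^+ M.+1).
  have [uv|/ltW vu] := leP u v.
    by rewrite mulr_ge0 ?subr_ge0// lerXn2r.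
  by rewrite mulr_le0 ?subr_le0// lerXn2r.
have := ler_wpM2r v0 IH.
rewrite -[M.+2%:R]natr1 -[M.+1%:R]natr1 !(exprS _ M.+1) in H *.
by rewrite exprS in H *; nra.
Qed.

Lemma bernoulli_expr (u : R) M : 0 <= u <= 1 -> 1 - M%:R * (1 - u) <= u ^+ M.
Proof.
move=> /andP[u0 u1]; elim: M => [|M IH]; first by rewrite mul0r subr0 expr0.
have := ler_wpM2l u0 IH; rewrite -exprS; apply: le_trans.
rewrite -natr1; have : 0 <= M%:R * ((1 - u) * (1 - u)).
  by rewrite mulr_ge0// mulr_ge0// subr_ge0.
by rewrite -subr_ge0; lra.
Qed.

(** The auxiliary [f u] is the probability that at most one of [M.+1] independent values exceeds a
    level that each exceeds with probability [1 - u], so it describes the second largest value. By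
    [young_expr] each summand dominates the increment of [f] over its cell, and these increments
    telescope. *)
Lemma telescoping_bound g M J : nondecreasing_seq g -> (forall j, 0 <= g j <= 1) ->
  1 - M%:R * (1 - g J) - M.+1%:R * g 0%N ^+ M <=
  M.+1%:R * \sum_(j < J) (1 - g j) * (g j.+1 ^+ M - g j ^+ M).
Proof.
move=> g_nd g01; pose f (u : R) := M.+1%:R * u ^+ M - M%:R * u ^+ M.+1.
have fJ : 1 - M%:R * (1 - g J) <= f (g J).
  apply: (le_trans (bernoulli_expr M (g01 J))).
  have /andP[gJ0 gJ1] := g01 J.
  rewrite /f -natr1 exprS; have : 0 <= M%:R * g J ^+ M * (1 - g J).
    by rewrite !mulr_ge0 ?exprn_ge0// subr_ge0.
  by rewrite -subr_ge0; lra.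
have f0 : f (g 0%N) <= M.+1%:R * g 0%N ^+ M.
  by rewrite /f gerBl mulr_ge0// exprn_ge0//; have /andP[] := g01 0%N.
suff : f (g J) - f (g 0%N) <= M.+1%:R * \sum_(j < J) (1 - g j) * (g j.+1 ^+ M - g j ^+ M).
  by lra.
elim: (J) => [|i IH]; first by rewrite subrr big_ord0 mulr0.
rewrite big_ord_recr/= mulrDr.
suff : f (g i.+1) - f (g i) <= M.+1%:R * ((1 - g i) * (g i.+1 ^+ M - g i ^+ M)) by lra.
have /andP[gi0 _] := g01 i; have /andP[gi1 _] := g01 i.+1.
have := young_expr M gi0 gi1.
by rewrite /f -natr1 [g i ^+ M.+1]exprS; lra.
Qed.

(** The weight [b j.+1] sits at the upper end of the cell and the tail [1 - g j] at the lower end;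
    [r] pays for this shift and for the errors of the tail estimates. It is paid once over all
    cells, because the increments of the powers sum to at most 1. *)
Lemma weighted_telescoping_bound g b (p r : R) M J :
  nondecreasing_seq g -> (forall j, 0 <= g j <= 1) -> 0 <= p <= 1 -> 0 <= r ->
  (forall j, p * (1 - g j) - r <= b j.+1) ->
  p - M.+1%:R * ((1 - g J) + g 0%N ^+ M + r) <=
  M.+1%:R * \sum_(j < J) b j.+1 * (g j.+1 ^+ M - g j ^+ M).
Proof.
move=> g_nd g01 /andP[p0 p1] r0 bge.
have d0 j : 0 <= g j.+1 ^+ M - g j ^+ M.
  rewrite subr_ge0 lerXn2r// ?nnegrE.
  - by have /andP[] := g01 j.
  - by have /andP[] := g01 j.+1.
  - exact: g_nd.
have sum1 : \sum_(j < J) (g j.+1 ^+ M - g j ^+ M) <= 1.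
  rewrite -(big_mkord predT (fun j => g j.+1 ^+ M - g j ^+ M)) telescope_sumr//.
  have : 0 <= g 0%N ^+ M by rewrite exprn_ge0//; have /andP[] := g01 0%N.
  have : g J ^+ M <= 1 by rewrite exprn_ile1//; have /andP[] := g01 J.
  lra.
apply: (@le_trans _ _ (M.+1%:R * (p * \sum_(j < J) (1 - g j) * (g j.+1 ^+ M - g j ^+ M)
    - r * \sum_(j < J) (g j.+1 ^+ M - g j ^+ M)))); last first.
  apply: ler_wpM2l => //; rewrite !mulr_sumr -sumrB; apply: ler_sum => j _.
  by have := ler_wpM2r (d0 j) (bge j); lra.
have := ler_wpM2l p0 (telescoping_bound M J g_nd g01).
have := ler_wpM2l (ler0n R M.+1) (ler_wpM2l r0 sum1).
have gJ : 0 <= 1 - g J by have := g01 J; lra.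
have := ler_piMl (mulr_ge0 (ler0n R M.+1) gJ) p1.
have := ler_piMl (mulr_ge0 (ler0n R M.+1) (exprn_ge0 M (proj1 (andP (g01 0%N))))) p1.
have := mulr_ge0 p0 gJ.
rewrite -natr1; lra.
Qed.

(* [x j ^ -alpha] decreases from [y ^ -alpha] to [0] by steps of at most [y ^ -beta]. *)
Definition grid (alpha beta y : R) (j : nat) : R :=
  y * (1 + j%:R * y `^ (alpha - beta)) `^ alpha^-1.

Section grid.
Variables (alpha beta y : R).
Hypotheses (alpha0 : 0 < alpha) (y0 : 0 < y).
Local Notation x := (grid alpha beta y).
Local Notation kappa := (y `^ (alpha - beta)).

Let kappa0 : 0 < kappa. Proof. exact: powR_gt0. Qed.

Let c1 j : 1 <= 1 + j%:R * kappa.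
Proof. by rewrite lerDl mulr_ge0// ltW. Qed.

Lemma grid0 : x 0 = y.
Proof. by rewrite /grid mul0r addr0 powR1 mulr1. Qed.

Lemma grid_nd : nondecreasing_seq x.
Proof.
move=> i j ij; rewrite /grid ler_pM2l// ge0_ler_powR// ?nnegrE.
- by rewrite invr_ge0 ltW.
- by apply: le_trans (c1 i).
- by apply: le_trans (c1 j).
- by rewrite lerD2l ler_wpM2r ?ler_nat// ltW.
Qed.

Lemma grid_powR j : x j `^ (- alpha) = y `^ (- alpha) / (1 + j%:R * kappa).
Proof.
have c0 : 0 < 1 + j%:R * kappa by apply: lt_le_trans (c1 j).
rewrite /grid powRM ?powR_ge0 ?(ltW y0)// -powRrM mulrN mulVf ?gt_eqF//.
by rewrite [X in _ * X]powRN powRr1// ltW.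
Qed.

Let powE : y `^ (- alpha) * kappa = y `^ (- beta).
Proof. by rewrite -powRD ?(gt_eqF y0) ?implybT//; congr powR; ring. Qed.

Lemma grid_step j : x j `^ (- alpha) - x j.+1 `^ (- alpha) <= y `^ (- beta).
Proof.
rewrite !grid_powR -powE -mulrBr ler_wpM2l ?powR_ge0//.
have := c1 j; have := c1 j.+1; rewrite -natr1.
set u := j%:R * kappa => h1 h2.
have u0 : 0 < 1 + u by lra.
have v0 : 0 < 1 + (j%:R + 1) * kappa by lra.
rewrite [leLHS](_ : _ = kappa / ((1 + u) * (1 + (j%:R + 1) * kappa))); last first.
  by rewrite /u; field; rewrite !gt_eqF.
by rewrite ler_piMr ?(ltW kappa0)// invf_le1 ?mulr_gt0//; apply: mulr_ege1.
Qed.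

(** By [grid_powR] any [J] beyond [y ^ -alpha / (kappa * y ^ -beta)] will do; the size of [J] never
    enters the later bounds. *)
Lemma grid_last : exists J, x J `^ (- alpha) <= y `^ (- beta).
Proof.
exists (Num.bound (y `^ (- alpha) / (kappa * y `^ (- beta)))); rewrite grid_powR.
set J := Num.bound _.
have b0 : 0 < y `^ (- beta) by exact: powR_gt0.
have : y `^ (- alpha) / (kappa * y `^ (- beta)) < J%:R.
  by apply: le_lt_trans (archi_boundP _); rewrite ?ler_norm// divr_ge0 ?powR_ge0// mulr_ge0// ltW.
rewrite ltr_pdivrMr ?mulr_gt0// => h.
by rewrite ler_pdivrMr ?(lt_le_trans ltr01 (c1 J))//; lra.
Qed.

End grid.

End telescoping.

Section rates.
Context {R : realType}.

Lemma grid_tail_bound (alpha beta y s p K : R) (h hD : R -> R) :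
  0 < alpha -> alpha < beta -> 1 <= y -> 0 <= s -> 0 <= K -> 0 <= p <= 1 ->
  (forall x, 0 <= h x <= 1) -> {homo h : x x' / x <= x' >-> x' <= x} ->
  (forall x, y <= x -> h x <= s * x `^ (- alpha) + K * x `^ (- beta)) ->
  (forall x, y <= x -> p * s * x `^ (- alpha) - K * x `^ (- beta) <= hD x) ->
  forall J M, grid alpha beta y J `^ (- alpha) <= y `^ (- beta) ->
  p - M.+1%:R * ((2 * s + 3 * K) * y `^ (- beta) + (1 - h y) ^+ M) <=
  M.+1%:R * \sum_(j < J) hD (grid alpha beta y j.+1) *
    ((1 - h (grid alpha beta y j.+1)) ^+ M - (1 - h (grid alpha beta y j)) ^+ M).
Proof.
have aux (a b c d e f : R) : a <= b + d -> c - d <= f -> b - c <= e ->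
    a - (e + 2 * d) <= f by lra.
have aux2 (a b c d e : R) : a <= s * b + K * c -> s * b <= s * d -> K * c <= K * d ->
    1 - (1 - a) + e + (s + 2 * K) * d <= (2 * s + 3 * K) * d + e by lra.
move=> alpha0 ab y1 s0 K0 /andP[p0 p1] h01 h_ni hle hDge J M xJ.
have y0 : 0 < y by lra.
set x := grid alpha beta y.
rewrite -/x in xJ.
have yx j : y <= x j by rewrite -[leLHS](grid0 alpha beta y); exact: grid_nd.
have xb j : x j `^ (- beta) <= y `^ (- beta).
  rewrite !powRN lef_pV2 ?posrE ?powR_gt0//; last exact: lt_le_trans (yx j).
  by apply: ge0_ler_powR; rewrite ?nnegrE ?yx//; [lra|lra|exact/ltW/(lt_le_trans y0)].
set v := y `^ (- beta) in xJ xb *.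
have v0 : 0 <= v by exact: powR_ge0.
(* In [r] the term [s * v] is the step of the grid and [2 * K * v] the error of the two tail
   estimates. The end of the grid adds [(s + K) * v], whence [2 * s + 3 * K]. *)
apply: (@le_trans _ _ (p - M.+1%:R * ((1 - (1 - h (x J))) + (1 - h (x 0%N)) ^+ M +
    (s + 2 * K) * v))); last apply: (@weighted_telescoping_bound _
    (fun j => 1 - h (x j)) (fun j => hD (x j))).
- rewrite /x grid0 lerD2l lerN2 ler_wpM2l//.
  exact: aux2 (hle _ (yx J)) (ler_wpM2l s0 xJ) (ler_wpM2l K0 (xb J)).
- by move=> i j ij; rewrite lerB// h_ni//; exact: grid_nd.
- by move=> j; have := h01 (x j); lra.
- by rewrite p0 p1.
- by rewrite mulr_ge0//; lra.
- move=> j.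
  have E1 : p * h (x j) <= p * s * x j `^ (- alpha) + K * v.
    apply: (le_trans (ler_wpM2l p0 (hle _ (yx j)))); rewrite mulrDr mulrA lerD2l.
    apply: (le_trans (ler_piMl (mulr_ge0 K0 (powR_ge0 _ _)) p1)).
    exact: (ler_wpM2l K0 (xb j)).
  have E2 : p * s * x j.+1 `^ (- alpha) - K * v <= hD (x j.+1).
    by apply: le_trans (hDge _ (yx j.+1)); rewrite lerD2l lerN2 (ler_wpM2l K0 (xb j.+1)).
  have E3 : p * s * x j `^ (- alpha) - p * s * x j.+1 `^ (- alpha) <= s * v.
    rewrite -mulrBr; apply: (le_trans (ler_wpM2l (mulr_ge0 p0 s0) (grid_step beta alpha0 y0 j))).
    by rewrite -mulrA ler_piMl// mulr_ge0.
  rewrite (_ : 1 - (1 - h (x j)) = h (x j)); last by ring.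
  rewrite [(s + _) * v]mulrDl -[2 * K * v]mulrA.
  exact: aux E1 E2 E3.
Qed.

Lemma near_natr_powR (a A : R) : 0 < a -> \forall N \near \oo, A <= N%:R `^ a.
Proof.
move=> a0; have [A0|A0] := leP A 0.
  by near=> N; apply: le_trans A0 _; exact: powR_ge0.
near=> N.
rewrite [A](_ : _ = (A `^ a^-1) `^ a); last first.
  by rewrite -powRrM mulVf ?gt_eqF// powRr1// ltW.
apply: ge0_ler_powR; rewrite ?nnegrE ?powR_ge0// ?(ltW a0)//.
near: N; exact: nbhs_infty_ger.
Unshelve. all: by end_near. Qed.

Lemma near_natr_powRN (a C e : R) : 0 < a -> 0 < e ->
  \forall N \near \oo, C * N%:R `^ (- a) <= e.
Proof.
move=> a0 e0; near=> N.
have N0 : 0 < N%:R `^ a by apply: powR_gt0; rewrite ltr0n; near: N; exact: nbhs_infty_gt.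
rewrite powRN ler_pdivrMr// mulrC -ler_pdivrMr//; near: N; exact: near_natr_powR.
Unshelve. all: by end_near. Qed.

Lemma expRN_le (t : R) k : 0 < t -> expR (- t) <= k.+1`!%:R / t ^+ k.+1.
Proof.
move=> t0; rewrite expRN -[leRHS]invrK lef_pV2 ?posrE ?expR_gt0 ?invr_gt0 ?divr_gt0//;
  rewrite ?ltr0n ?fact_gt0 ?exprn_gt0//.
by rewrite invfM invrK mulrC; have := expR_ge1Dxn k (ltW t0); lra.
Qed.

(** * Growth of the group sizes and negligibility of the bias *)

Section group_sizes.
Variables (alpha beta zeta eps : R) (n m : nat -> nat).
Hypotheses (alpha_gt0 : 0 < alpha) (lt_alpha_beta : alpha < beta)
  (zetaE : zeta = Num.min ((beta - alpha) / alpha) 1)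
  (eps_gt0 : 0 < eps) (eps_small : eps < 2 * zeta / (1 + 2 * zeta))
  (nE : forall N, n N = Num.truncn (N%:R `^ (2 * zeta / (1 + 2 * zeta) - eps)))
  (mE : (forall N, m N = Num.truncn (N%:R `^ (1 / (1 + 2 * zeta) + eps))) \/
        (forall N, m N = (N %/ n N)%N)).

Let A := 2 * zeta / (1 + 2 * zeta) - eps.
Let D := 1 / (1 + 2 * zeta) + eps.

Let zeta_gt0 : 0 < zeta.
Proof. by rewrite zetaE lt_min ltr01 divr_gt0// subr_gt0. Qed.

Let A_gt0 : 0 < A. Proof. by rewrite subr_gt0. Qed.

Let zeta_gt1 : 0 < 1 + 2 * zeta.
Proof. by rewrite addr_gt0// mulr_gt0. Qed.

Let D_gt0 : 0 < D.
Proof. by rewrite addr_gt0// divr_gt0. Qed.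

Let AD : A + D = 1.
Proof. by rewrite /A /D; field; rewrite gt_eqF. Qed.

Lemma n_le N : (n N)%:R <= N%:R `^ A.
Proof. by rewrite nE truncn_le// powR_ge0. Qed.

Lemma near_n_ge : \forall N \near \oo, N%:R `^ A / 2 <= (n N)%:R.
Proof.
near=> N.
have h2 : 2 <= N%:R `^ A by near: N; exact: near_natr_powR.
have := truncnS_gt (N%:R `^ A); rewrite -nE -natr1; lra.
Unshelve. all: by end_near. Qed.

Lemma near_n_gt (C : R) : \forall N \near \oo, C <= (n N)%:R.
Proof.
near=> N.
have h1 : C * 2 <= N%:R `^ A by near: N; exact: near_natr_powR.
have : N%:R `^ A / 2 <= (n N)%:R by near: N; exact: near_n_ge.
lra.
Unshelve. all: by end_near. Qed.

(** The factors 2 accommodate both readings of [m]: the rounded power, or [N] divided by [n], which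
    itself lies between half its power and that power. *)
Lemma near_m : \forall N \near \oo, N%:R `^ D / 2 <= (m N)%:R <= 2 * N%:R `^ D.
Proof.
near=> N.
have h2 : 2 <= N%:R `^ D by near: N; exact: near_natr_powR.
case: mE => [mE'|mE'].
  have := truncnS_gt (N%:R `^ D); rewrite -mE' -natr1.
  have : (m N)%:R <= N%:R `^ D by rewrite mE' truncn_le// powR_ge0.
  lra.
have N0 : (0 < N)%N by near: N; exact: nbhs_infty_gt.
have NA0 : 0 < N%:R `^ A :> R by apply: powR_gt0; rewrite ltr0n.
have n1 := n_le N.
have n2 : N%:R `^ A / 2 <= (n N)%:R by near: N; exact: near_n_ge.
have n0 : (0 < n N)%N by rewrite -(ltr0n R); apply: lt_le_trans n2; rewrite divr_gt0.
have NN : N%:R = N%:R `^ A * N%:R `^ D :> R.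
  by rewrite -powRD ?AD ?powRr1// gt_eqF// ?implybT// ltr0n.
have m1 : (m N)%:R * (n N)%:R <= N%:R :> R by rewrite mE' -natrM ler_nat leq_trunc_div.
have m2 : N%:R <= ((m N)%:R + 1) * (n N)%:R :> R.
  by rewrite natr1 -natrM ler_nat mE' ltnW// ltn_ceil.
have nR0 : 0 < (n N)%:R :> R by rewrite ltr0n.
apply/andP; split.
  have : N%:R `^ A * N%:R `^ D <= ((m N)%:R + 1) * N%:R `^ A.
    by rewrite -NN; apply: (le_trans m2); rewrite ler_wpM2l// addr_ge0.
  by rewrite mulrC ler_pM2r//; lra.
have : (m N)%:R * (N%:R `^ A / 2) <= N%:R `^ A * N%:R `^ D.
  by rewrite -NN; apply: le_trans m1; rewrite ler_wpM2l.
by rewrite [leLHS](_ : _ = N%:R `^ A * ((m N)%:R / 2)) ?ler_pM2l//; [lra|ring].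
Unshelve. all: by end_near. Qed.

Lemma sqrt_n_le N : Num.sqrt (n N)%:R <= N%:R `^ (A / 2).
Proof. by rewrite powRrM powR12_sqrt ?powR_ge0// ler_wsqrtr// n_le. Qed.

(** Lowering the exponent of the threshold by [tau / alpha] costs [tau * beta / alpha = eps / 2] in
    the power bias, within the margin [eps * zeta + eps / 2] left by the sizes. *)
Let tau := eps * alpha / (2 * beta).

(* Then [m * threshold ^ -alpha] grows like [N ^ tau] while [sqrt n * m * threshold ^ -beta]
   still tends to 0. *)
Definition threshold (N : nat) : R := N%:R `^ ((D - tau) / alpha).

Let beta0 : 0 < beta. Proof. exact: lt_trans lt_alpha_beta. Qed.

Let tau_gt0 : 0 < tau. Proof. by rewrite divr_gt0// mulr_gt0. Qed.

Let tau_lt : tau < eps.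
Proof.
rewrite /tau ltr_pdivrMr ?mulr_gt0// ltr_pM2l//. have := lt_alpha_beta; have := alpha_gt0; lra.
Qed.

Let Dtau_gt0 : 0 < D - tau.
Proof.
have : 0 < 1 / (1 + 2 * zeta) by rewrite divr_gt0.
by have := tau_lt; rewrite /D; lra.
Qed.

Lemma near_threshold (C : R) : \forall N \near \oo, C <= threshold N.
Proof. by apply: near_natr_powR; rewrite divr_gt0. Qed.

Lemma near_bias_power (e : R) : 0 < e ->
  \forall N \near \oo, Num.sqrt (n N)%:R * (m N)%:R * threshold N `^ (- beta) <= e.
Proof.
move=> e0; near=> N.
have N0 : (N%:R : R) != 0 by rewrite gt_eqF// ltr0n; near: N; exact: nbhs_infty_gt.
have /andP[_ mN] : N%:R `^ D / 2 <= (m N)%:R <= 2 * N%:R `^ D.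
  by near: N; exact: near_m.
apply: (@le_trans _ _ (N%:R `^ (A / 2) * (2 * N%:R `^ D) * threshold N `^ (- beta))).
  by rewrite ler_wpM2r ?powR_ge0// ler_pM// sqrt_n_le.
rewrite /threshold -powRrM mulrCA -mulrA -!powRD ?N0 ?implybT//.
rewrite (_ : A / 2 + D + (D - tau) / alpha * - beta =
  - ((D * (beta - alpha) / alpha - A / 2) - eps / 2)); last first.
  by rewrite /tau; field; rewrite !gt_eqF.
near: N; apply: near_natr_powRN => //.
(* As [D * zeta = A / 2 + eps * zeta + eps / 2], the decay exponent is at least [eps * zeta]. *)
have : D * zeta <= D * ((beta - alpha) / alpha).
  by rewrite ler_wpM2l ?(ltW D_gt0)// zetaE ge_min lexx.
have : A / 2 = D * zeta - eps * zeta - eps / 2.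
  by rewrite /A /D; field; rewrite gt_eqF.
have : 0 < eps * zeta by rewrite mulr_gt0.
rewrite -mulrA; lra.
Unshelve. all: by end_near. Qed.

Lemma near_bias_exp (c e : R) : 0 < c -> 0 < e ->
  \forall N \near \oo, Num.sqrt (n N)%:R * (m N)%:R *
    expR (- (c * (m N).-1%:R * threshold N `^ (- alpha))) <= e.
Proof.
move=> c0 e0.
(* The prefactor is of order at most [N ^ (A / 2 + D)], and [A / 2 + D < 2] because [A + D = 1]. *)
have [k ktau] : exists k, 2 <= k.+1%:R * tau.
  exists (Num.bound (2 / tau)).
  have : 2 / tau < (Num.bound (2 / tau))%:R.
    by apply: le_lt_trans (archi_boundP _); rewrite ?ler_norm// divr_ge0// ltW.
  by rewrite ltr_pdivrMr// => h; rewrite -natr1; have := tau_gt0; lra.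
near=> N.
have N1 : (1 : R) <= N%:R by rewrite ler1n; near: N; exact: nbhs_infty_gt.
have N0 : (N%:R : R) != 0 by rewrite gt_eqF//; lra.
have /andP[m1 m2] : N%:R `^ D / 2 <= (m N)%:R <= 2 * N%:R `^ D.
  by near: N; exact: near_m.
have D4 : 4 <= N%:R `^ D by near: N; exact: near_natr_powR.
have mP : N%:R `^ D / 4 <= (m N).-1%:R.
  case: (m N) m1 => [|M]; first by rewrite /=; lra.
  by rewrite -[M.+1%:R]natr1 succnK; lra.
have tE : threshold N `^ (- alpha) = N%:R `^ (tau - D).
  by rewrite /threshold -powRrM; congr powR; field; rewrite gt_eqF.
have t1 : c / 4 * N%:R `^ tau <= c * (m N).-1%:R * threshold N `^ (- alpha).
  rewrite tE [leLHS](_ : _ = c * (N%:R `^ D / 4) * N%:R `^ (tau - D)).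
    by rewrite ler_wpM2r ?powR_ge0// ler_wpM2l// ltW.
  have -> : N%:R `^ tau = N%:R `^ D * N%:R `^ (tau - D).
    by rewrite -powRD ?N0 ?implybT//; congr powR; ring.
  by ring.
have ct0 : 0 < c / 4 * N%:R `^ tau by rewrite mulr_gt0 ?powR_gt0 ?divr_gt0//; lra.
apply: (@le_trans _ _ (N%:R `^ (A / 2) * (2 * N%:R `^ D) *
    (k.+1`!%:R / (c / 4 * N%:R `^ tau) ^+ k.+1))).
  apply: ler_pM => //; rewrite ?expR_ge0 ?mulr_ge0//.
    by rewrite ler_pM// sqrt_n_le.
  by apply: le_trans (expRN_le k ct0); rewrite ler_expR lerN2.
have tk : (N%:R `^ tau) ^+ k.+1 = N%:R `^ (tau * k.+1%:R).
  by rewrite powRrM powR_mulrn// powR_ge0.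
have -> : N%:R `^ (A / 2) * (2 * N%:R `^ D) * (k.+1`!%:R / (c / 4 * N%:R `^ tau) ^+ k.+1) =
    2 * k.+1`!%:R / (c / 4) ^+ k.+1 * N%:R `^ (- (tau * k.+1%:R - A / 2 - D)).
  rewrite exprMn tk invfM (_ : - _ = A / 2 + D - tau * k.+1%:R); last by ring.
  by rewrite !powRD ?N0 ?implybT// [N%:R `^ (- _)]powRN; ring.
near: N; apply: near_natr_powRN => //.
have := AD; have := A_gt0; lra.
Unshelve. all: by end_near. Qed.

End group_sizes.
End rates.

(** * Studentized sums between two binomial variables *)

Section studentization.
Context {R : realType}.

(** Difference of squares: the variances differ by [(u - p) * (1 - u - p)], whose second factor is
    at most 1 in absolute value. *)
Lemma sqrt_bernoulli_variance (p u : R) : 0 < p < 1 -> 0 <= u <= 1 ->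
  `|Num.sqrt (u * (1 - u)) - Num.sqrt (p * (1 - p))| <=
  `|u - p| / Num.sqrt (p * (1 - p)).
Proof.
move=> /andP[p0 p1] /andP[u0 u1].
have v0 : 0 < p * (1 - p) by rewrite mulr_gt0// subr_gt0.
have w0 : 0 <= u * (1 - u) by rewrite mulr_ge0// subr_ge0.
set s := Num.sqrt (p * (1 - p)); set D := Num.sqrt (u * (1 - u)).
have s0 : 0 < s by rewrite sqrtr_gt0.
have D0 : 0 <= D by exact: sqrtr_ge0.
have s2 : s ^+ 2 = p * (1 - p) by rewrite sqr_sqrtr// ltW.
have D2 : D ^+ 2 = u * (1 - u) by rewrite sqr_sqrtr.
rewrite ler_pdivlMr//.
have E : `|D - s| * (D + s) = `|u - p| * `|1 - u - p|.
  rewrite -[D + s]ger0_norm ?addr_ge0// ?(ltW s0)// -!normrM -subr_sqr D2 s2.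
  by congr `|_|; ring.
apply: (@le_trans _ _ (`|D - s| * (D + s))); first by rewrite ler_wpM2l// lerDr.
by rewrite E ler_piMr// ler_norml; apply/andP; split; lra.
Qed.

(** Clear the denominators: replacing [p] by [q] costs at most [kappa], and replacing the empirical
    deviation by [S] costs [|t|] times their difference. Together they must stay below [e * S]. *)
Lemma studentized_vs_standardized (p t e : R) : 0 < p < 1 -> 0 < e ->
  exists2 kappa : R, 0 < kappa & forall r u q : R,
  1 <= r -> `|u - p| <= kappa -> r * `|q - p| <= kappa ->
  let S := Num.sqrt (q * (1 - q)) in
  let T := r * (u - p) / Num.sqrt (u - u ^+ 2) in
  [/\ 0 < q < 1, Num.sqrt (p * (1 - p)) / 2 <= S,
   T <= t -> forall x, x <= u -> r * (x - q) / S <= t + e &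
   t < T -> forall x, u <= x -> t - e < r * (x - q) / S].
Proof.
move=> p01 e0; have /andP[p0 p1] := p01.
have v0 : 0 < p * (1 - p) by rewrite mulr_gt0// subr_gt0.
set s := Num.sqrt (p * (1 - p)).
have s0 : 0 < s by rewrite sqrtr_gt0.
have s2 : s ^+ 2 = p * (1 - p) by rewrite sqr_sqrtr// ltW.
pose C := 2 * (2 * `|t| / s + 1).
have C0 : 0 < C by rewrite mulr_gt0// ltr_wpDl// divr_ge0 ?mulr_ge0// ltW.
(* The first bound keeps [u] and [q] inside the unit interval and both deviations above [s / 2]; the
   second gives [kappa * C / 2 <= e * s / 2], where [kappa * C / 2] is the total cost. *)
exists (Num.min (s ^+ 2 / 2) (e * s / C)).
  by rewrite lt_min; apply/andP; split; apply: divr_gt0 => //; [exact: exprn_gt0|exact: mulr_gt0].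
set k := Num.min _ _ => r u q r1 uk rqk S T.
have [k1 k2] : k <= s ^+ 2 / 2 /\ k <= e * s / C by rewrite !ge_min !lexx orbT.
have qk : `|q - p| <= k by apply: le_trans rqk; rewrite ler_peMl.
have close x : `|x - p| <= k -> 0 < x < 1.
  rewrite ler_norml => /andP[xl xr]; rewrite s2 in k1.
  by apply/andP; split; nra.
have /andP[u0 u1] := close _ uk; have /andP[q0 q1] := close _ qk.
have root x : `|x - p| <= k -> `|Num.sqrt (x * (1 - x)) - s| <= k / s.
  move=> xk; have /andP[/ltW x0 /ltW x1] := close _ xk.
  apply: le_trans (sqrt_bernoulli_variance p01 _) _; first by rewrite x0 x1.
  by rewrite ler_pM2r ?invr_gt0.
have ks : k / s <= s / 2.
  rewrite ler_pdivrMr//; apply: (le_trans k1); rewrite le_eqVlt; apply/orP; left.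
  by apply/eqP; ring.
have uu : u - u ^+ 2 = u * (1 - u) by ring.
rewrite /T uu; set D := Num.sqrt (u * (1 - u)).
have rS := root _ qk; have rD := root _ uk; rewrite -/S -/D in rS rD.
have Ss : s / 2 <= S by move: rS; rewrite ler_norml => /andP[? ?]; lra.
have Ds : s / 2 <= D by move: rD; rewrite ler_norml => /andP[? ?]; lra.
have S0 : 0 < S by lra.
have D0 : 0 < D by lra.
have rqp : `|r * (p - q)| <= k by rewrite normrM distrC ger0_norm//; lra.
have tDS : `|t * (D - S)| + k <= e * S.
  have DS : `|D - S| <= 2 * (k / s).
    rewrite (_ : D - S = (D - s) - (S - s)); last by ring.
    by apply: (le_trans (ler_normB _ _)); lra.
  rewrite normrM; apply: (@le_trans _ _ (`|t| * (2 * (k / s)) + k)).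
    by rewrite lerD2r ler_wpM2l.
  rewrite (_ : _ + k = k * C / 2); last by rewrite /C; field; rewrite gt_eqF.
  move: k2; rewrite ler_pdivlMr// => k2.
  by have := ler_wpM2l (ltW e0) Ss; lra.
split=> //; first by rewrite q0 q1.
  rewrite ler_pdivrMr// => Tt x xu; rewrite ler_pdivrMr//.
  have : r * (x - q) <= r * (u - p) + r * (p - q).
    by rewrite -mulrDr ler_pM2l; lra.
  by move: tDS rqp; rewrite ler_norml => ? /andP[? ?]; have := ler_norm (t * (D - S)); lra.
rewrite ltr_pdivlMr// => Tt x xu; rewrite ltr_pdivlMr//.
have : r * (u - p) + r * (p - q) <= r * (x - q).
  by rewrite -mulrDr ler_pM2l; lra.
move: tDS rqp; rewrite ler_norml => ? /andP[? ?].
by have := ler_norm (- (t * (D - S))); rewrite normrN; lra.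
Qed.

Lemma binE_chebyshev n (q k : R) : 0 <= q <= 1 -> 0 < k -> (0 < n)%N ->
  binE q n (fun i => (k * n%:R <= `|i%:R - n%:R * q|)%R%:R) <= (k ^+ 2 * n%:R)^-1.
Proof.
move=> q01 k0 n0; have nR : 0 < n%:R :> R by rewrite ltr0n.
have kn : 0 < (k * n%:R) ^+ 2 by rewrite exprn_gt0// mulr_gt0.
apply: (@le_trans _ _ (binE q n (fun i => (k * n%:R) ^- 2 * (i%:R - n%:R * q) ^+ 2))).
  apply: ler_binE => // i; case: (leP (k * n%:R) _) => h; last first.
    by rewrite mulr_ge0// ?sqr_ge0// invr_ge0 ltW.
  rewrite mulrC ler_pdivlMr// mul1r -[leRHS]real_normK ?num_real//.
  by rewrite lerXn2r// nnegrE// mulr_ge0// ltW.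
rewrite binEZ binE_variance.
rewrite (_ : _ * _ = (k ^+ 2 * n%:R)^-1 * (q * (1 - q))); last by field; rewrite !gt_eqF.
apply: ler_piMr; first by rewrite invr_ge0 mulr_ge0// sqr_ge0.
by move: q01 => /andP[q0 q1]; nra.
Qed.

End studentization.

(** * Normal approximation for a count between two binomial counts *)

Section sandwich.
Context {R : realType} {d : measure_display} {Omega : measurableType d}
  (P : probability Omega R).

Definition binomial_law (n : nat) (q : R) (a : Omega -> nat) :=
  forall Q : pred nat, measurable [set w | Q (a w)] /\
    P [set w | Q (a w)] = (binE q n (fun k => (Q k)%:R))%:E.

(** Outside an event of probability at most [e / 2], where an outer count is far from its mean, the
    event [T w <= t] is compared with events on the standardized outer counts: [a] bounds its
    probability from above and [c] from below. Half of the shift [e] comes from the denominators and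
    half from smoothing. *)
Lemma sandwich_bound (p t e : R) : 0 < p < 1 -> 0 < e ->
  exists2 kappa : R, 0 < kappa & forall n (q1 q2 : R) (a b c : Omega -> nat),
  kappa^-1 <= n%:R -> Num.sqrt n%:R * `|q1 - p| <= kappa ->
  Num.sqrt n%:R * `|q2 - p| <= kappa ->
  binomial_law n q1 a -> binomial_law n q2 c ->
  (forall Q : pred nat, measurable [set w | Q (b w)]) ->
  (forall w, (a w <= b w <= c w)%N) ->
  let T w := Num.sqrt n%:R * ((b w)%:R / n%:R - p) /
    Num.sqrt ((b w)%:R / n%:R - ((b w)%:R / n%:R) ^+ 2) in
  normal_cdf (t - e) - e <= fine (P [set w | T w <= t]) /\
  fine (P [set w | T w <= t]) <= normal_cdf (t + e) + e.
Proof.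
move=> p01 e0; have /andP[p0 p1] := p01.
have e2 : 0 < e / 2 by rewrite divr_gt0.
have e4 : 0 < e / 4 by rewrite divr_gt0.
have [k k0 cmp] := studentized_vs_standardized t p01 e2.
have [L1 cdf1] := binomial_cdf (t + e / 2) e2.
have [L2 cdf2] := binomial_cdf (t - e / 2) e2.
have v0 : 0 < p * (1 - p) by rewrite mulr_gt0// subr_gt0.
set s := Num.sqrt (p * (1 - p)) in cmp.
have s0 : 0 < s by rewrite sqrtr_gt0.
(* For [n] above [M], the second summand makes the Stein errors at most [e / 2], and the third makes
   each Chebyshev bound at most [e / 4]. *)
pose M := 1 + (2 / s * (1 + 2 * (`|L1| + `|L2|) / e)) ^+ 2 + 4 / ((k / 2) ^+ 2 * e).
have M1 : 1 <= M.
  by rewrite /M -addrA lerDl addr_ge0 ?sqr_ge0// divr_ge0// mulr_ge0 ?sqr_ge0// ltW.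
have M0 : 0 < M by lra.
exists (Num.min (k / 2) M^-1); first by rewrite lt_min invr_gt0 M0 divr_gt0.
move=> n q1 q2 a b c nM q1p q2p la lc mb abc.
have {}nM : M <= n%:R.
  apply: le_trans nM; rewrite -[leLHS]invrK lef_pV2 ?posrE ?invr_gt0//.
    by rewrite ge_min lexx orbT.
  by rewrite lt_min invr_gt0 M0 divr_gt0.
have n1 : 1 <= n%:R :> R by lra.
have n0 : (0 < n)%N by rewrite -(ler1n R).
have nR : 0 < n%:R :> R by rewrite ltr0n.
set r := Num.sqrt n%:R in q1p q2p * => T.
have r1 : 1 <= r by rewrite -sqrtr1 ler_wsqrtr.
have r2 : r ^+ 2 = n%:R by rewrite sqr_sqrtr// ltW.
have {}q1p : r * `|q1 - p| <= k / 2 by apply: (le_trans q1p); rewrite ge_min lexx.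
have {}q2p : r * `|q2 - p| <= k / 2 by apply: (le_trans q2p); rewrite ge_min lexx.
have kk : k / 2 <= k by lra.
have pp : `|p - p| <= k by rewrite subrr normr0 ltW.
have [q101 S1 _ _] := cmp r p q1 r1 pp (le_trans q1p kk).
have [q201 S2 _ _] := cmp r p q2 r1 pp (le_trans q2p kk).
have q1p' : `|q1 - p| <= k / 2 by apply: le_trans q1p; rewrite ler_peMl.
have q2p' : `|q2 - p| <= k / 2 by apply: le_trans q2p; rewrite ler_peMl.
have sq q : Num.sqrt (n%:R * (q * (1 - q))) = r * Num.sqrt (q * (1 - q)).
  by rewrite sqrtrM// ltW.
have rM : 2 / s * (1 + 2 * (`|L1| + `|L2|) / e) <= r.
  have h : 0 <= 2 / s * (1 + 2 * (`|L1| + `|L2|) / e).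
    apply: mulr_ge0; first by rewrite divr_ge0// ltW.
    by rewrite addr_ge0// divr_ge0 ?(ltW e0)// mulr_ge0// addr_ge0.
  rewrite -[leLHS]ger0_norm// -sqrtr_sqr ler_wsqrtr//; apply: le_trans nM.
  rewrite /M addrAC lerDr; apply: addr_ge0 => //; apply: divr_ge0 => //.
  by rewrite mulr_ge0 ?sqr_ge0// ltW.
have big S : s / 2 <= S -> 1 + 2 * (`|L1| + `|L2|) / e <= r * S.
  move=> sS; apply: (@le_trans _ _ (r * (s / 2))); last by rewrite ler_wpM2l//; lra.
  have -> : 1 + 2 * (`|L1| + `|L2|) / e =
      2 / s * (1 + 2 * (`|L1| + `|L2|) / e) * (s / 2) by field; rewrite !gt_eqF.
  by apply: ler_wpM2r => //; rewrite divr_ge0// ltW.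
have Ls L S : s / 2 <= S -> `|L| <= `|L1| + `|L2| -> 1 <= r * S /\ `|L / (r * S)| <= e / 2.
  move=> /big bS LL; have h0 : 0 <= 2 * (`|L1| + `|L2|) / e.
    by rewrite divr_ge0 ?(ltW e0)// mulr_ge0// addr_ge0.
  have rS1 : 1 <= r * S by apply: le_trans bS; rewrite lerDl.
  have rS0 := lt_le_trans ltr01 rS1.
  split=> //.
  rewrite normrM normfV (gtr0_norm rS0) ler_pdivrMr//.
  apply: (le_trans LL); apply: (@le_trans _ _ (e / 2 * (1 + 2 * (`|L1| + `|L2|) / e))).
    rewrite [leRHS](_ : _ = e / 2 + (`|L1| + `|L2|)) ?lerDr ?(ltW e2)//.
    by field; rewrite gt_eqF.
  by rewrite ler_wpM2l// ltW.
have cheb q : 0 < q < 1 -> binE q n (fun i => (k / 2 * n%:R <= `|i%:R - n%:R * q|)%R%:R) <= e / 4.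
  move=> /andP[q0 q1']; apply: (le_trans (binE_chebyshev _ _ n0)); rewrite ?(ltW q0) ?(ltW q1')//.
    by rewrite divr_gt0.
  have k20 : 0 < (k / 2) ^+ 2 by rewrite exprn_gt0// divr_gt0.
  rewrite -[leRHS]invrK lef_pV2 ?posrE ?mulr_gt0 ?invr_gt0//.
  rewrite -ler_pdivrMl//; apply: le_trans nM; rewrite /M.
  rewrite (_ : _^-1 * _^-1 = 4 / ((k / 2) ^+ 2 * e)); last by field; rewrite !gt_eqF.
  by rewrite lerDr addr_ge0 ?sqr_ge0.
pose bad q i := k / 2 * n%:R <= `|i%:R - n%:R * q|.
have good x q : `|q - p| <= k / 2 -> ~~ bad q x -> `|x%:R / n%:R - p| <= k.
  move=> qp; rewrite /bad -ltNge => xq.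
  rewrite (_ : _ - p = (x%:R - n%:R * q) / n%:R + (q - p)); last by field; rewrite gt_eqF.
  apply: (le_trans (ler_normD _ _)); rewrite normrM normfV (gtr0_norm nR).
  by move: xq; rewrite -ltr_pdivrMr//; lra.
have mid w : ~~ bad q1 (a w) -> ~~ bad q2 (c w) -> `|(b w)%:R / n%:R - p| <= k.
  move=> /(good _ _ q1p') + /(good _ _ q2p').
  rewrite !ler_norml => /andP[h1 _] /andP[_ h2].
  have /andP[ab bc] := abc w.
  have nV : 0 <= n%:R^-1 :> R by rewrite invr_ge0.
  apply/andP; split.
    by apply: (le_trans h1); rewrite lerD2r ler_wpM2r// ler_nat.
  by apply: le_trans h2; rewrite lerD2r ler_wpM2r// ler_nat.
have stdE q S x : 0 < S -> r * (x%:R / n%:R - q) / S = (x%:R - n%:R * q) / (r * S).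
  by move=> S0; rewrite -r2; field; rewrite !gt_eqF//; lra.
pose W q x : bool := (x%:R - n%:R * q) / Num.sqrt (n%:R * (q * (1 - q))) <= t + e / 2.
pose W' q x : bool := (x%:R - n%:R * q) / Num.sqrt (n%:R * (q * (1 - q))) <= t - e / 2.
have mT : measurable [set w | T w <= t].
  exact: (mb (fun x : nat => Num.sqrt n%:R * (x%:R / n%:R - p) /
    Num.sqrt (x%:R / n%:R - (x%:R / n%:R) ^+ 2) <= t)).
have [mW PW] := la (W q1); have [mW' PW'] := lc (W' q2).
have [m1 P1] := la (bad q1); have [m2 P2] := lc (bad q2).
have PT : P [set w | T w <= t] = (fine (P [set w | T w <= t]))%:E.
  by rewrite fineK// fin_num_measure.
have mbad := measurableU _ _ m1 m2.
have Pbad : (P ([set w | bad q1 (a w)] `|` [set w | bad q2 (c w)]) <= (e / 2)%:E)%E.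
  apply: le_trans (measureU2 _ m1 m2) _; rewrite [X in (X + _)%E]P1 [X in (_ + X)%E]P2.
  by rewrite -EFinD lee_fin; have := cheb _ q101; have := cheb _ q201; rewrite /bad; lra.
have S10 : 0 < Num.sqrt (q1 * (1 - q1)) by lra.
have S20 : 0 < Num.sqrt (q2 * (1 - q2)) by lra.
have [rS1 Le1] : 1 <= r * Num.sqrt (q1 * (1 - q1)) /\
    `|L1 / (r * Num.sqrt (q1 * (1 - q1)))| <= e / 2.
  by apply: Ls => //; rewrite lerDl.
have [rS2 Le2] : 1 <= r * Num.sqrt (q2 * (1 - q2)) /\
    `|L2 / (r * Num.sqrt (q2 * (1 - q2)))| <= e / 2.
  by apply: Ls => //; rewrite lerDr.
split.
- have [] := cdf2 n q2; rewrite ?sq// => _ low.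
  have : (P [set w | W' q2 (c w)] <= (fine (P [set w | T w <= t]))%:E + (e / 2)%:E)%E.
    rewrite -PT; apply: (@le_trans _ _ (P ([set w | T w <= t] `|`
        ([set w | bad q1 (a w)] `|` [set w | bad q2 (c w)])))).
      apply: le_measure; rewrite ?inE//; first exact: measurableU.
      move=> w /= Ww; have [b1|b1] := boolP (bad q1 (a w)); first by right; left.
      have [b2|b2] := boolP (bad q2 (c w)); first by right; right.
      left; rewrite leNgt; apply/negP => tT.
      have [_ _ _ /(_ tT ((c w)%:R / n%:R))] := cmp r _ _ r1 (mid _ b1 b2) (le_trans q2p kk).
      rewrite stdE// -sq => h; move: Ww; rewrite /W' leNgt h//.
      by rewrite ler_pM2r ?invr_gt0// ler_nat; have /andP[] := abc w.
    apply: le_trans (measureU2 _ mT mbad) _.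
    by rewrite leeD2l.
  rewrite PW' -EFinD lee_fin; move: low Le2; rewrite ler_norml
    (_ : t - e / 2 - e / 2 = t - e); last by field.
  rewrite /W' sq; move=> ? /andP[? ?]; lra.
- have [] := cdf1 n q1; rewrite ?sq// => up _.
  have : ((fine (P [set w | T w <= t]))%:E <= P [set w | W q1 (a w)] + (e / 2)%:E)%E.
    rewrite -PT; apply: (@le_trans _ _ (P ([set w | W q1 (a w)] `|`
        ([set w | bad q1 (a w)] `|` [set w | bad q2 (c w)])))).
      apply: le_measure; rewrite ?inE//; first exact: measurableU.
      move=> w /= Tt; have [b1|b1] := boolP (bad q1 (a w)); first by right; left.
      have [b2|b2] := boolP (bad q2 (c w)); first by right; right.
      left.
      have [_ _ /(_ Tt ((a w)%:R / n%:R)) + _] := cmp r _ _ r1 (mid _ b1 b2) (le_trans q1p kk).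
      rewrite /W sq -stdE//; apply; rewrite ler_pM2r ?invr_gt0// ler_nat.
      by have /andP[] := abc w.
    apply: le_trans (measureU2 _ mW mbad) _.
    by rewrite leeD2l.
  rewrite PW -EFinD lee_fin; move: up Le1; rewrite ler_norml
    (_ : t + e / 2 + e / 2 = t + e); last by field.
  rewrite /W sq; move=> ? /andP[? ?]; lra.
Qed.

End sandwich.

(** * Directions and tails *)

Section directions.
Context {R : realType} {d : nat}.
Implicit Types (v : 'rV[R]_d) (B : set 'rV[R]_d).

Lemma enorm_ge0 v : 0 <= enorm v.
Proof. exact: sqrtr_ge0. Qed.

Lemma enormZ c v : enorm (c *: v) = `|c| * enorm v.
Proof.
rewrite /enorm -sqrtr_sqr -sqrtrM ?sqr_ge0//; congr Num.sqrt.
by rewrite mulr_sumr; apply: eq_bigr => i _; rewrite mxE exprMn.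
Qed.

Lemma direction_sphere v : 0 < enorm v -> sphere (direction v).
Proof.
move=> v0; rewrite /sphere /= /direction enormZ ger0_norm ?invr_ge0 ?enorm_ge0//.
by rewrite mulVf// gt_eqF.
Qed.

Lemma continuous_enorm : continuous (@enorm R d).
Proof.
have csum s : continuous (fun u : 'rV[R]_d => \sum_(i <- s) u ord0 i ^+ 2).
  elim: s => [|i s IH] v.
    have -> : (fun u : 'rV[R]_d => \sum_(i <- [::]) u ord0 i ^+ 2) = cst 0.
      by apply/funext => u; rewrite big_nil.
    exact: cst_continuous.
  have -> : (fun u : 'rV[R]_d => \sum_(j <- i :: s) u ord0 j ^+ 2) =
      (fun u : 'rV[R]_d => u ord0 i * u ord0 i + \sum_(j <- s) u ord0 j ^+ 2).
    by apply/funext => u; rewrite big_cons.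
  have c := @coord_continuous R 1 d ord0 i v.
  exact: (@cvgD _ _ _ (nbhs v) _ _ _ _ _ (@cvgM _ _ (nbhs v) _ _ _ _ _ c c) (IH v)).
move=> v; apply: (@continuous_comp _ _ _ (fun u : 'rV[R]_d => \sum_(i < d) u ord0 i ^+ 2)
  (@Num.sqrt R)); [exact: csum|exact: sqrt_continuous].
Qed.

Lemma measurable_enorm : measurable_fun setT (@enorm R d : borel_rV R d -> R).
Proof.
apply: (measurability (@RGenOInfty.G R)); first exact: RGenOInfty.measurableE.
move=> _ [_ [x ->] <-]; rewrite setTI; apply: sub_sigma_algebra => /=.
by apply: open_comp => [v _|]; [exact: continuous_enorm|exact: interval_open].
Qed.

Lemma measurable_sphere : measurable (sphere : set (borel_rV R d)).
Proof.
have := measurable_enorm measurableT (measurable_set1 (1 : R)).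
by rewrite setTI.
Qed.

(** Continuity holds off the origin only. Where [enorm] vanishes the direction is 0, so that part
    belongs to the preimage entirely or not at all. *)
Lemma measurable_direction :
  measurable_fun setT (direction : borel_rV R d -> borel_rV R d).
Proof.
apply: (@measurability _ _ (borel_rV R d) (borel_rV R d) setT _ (@open 'rV[R]_d)) => //.
move=> _ [U oU <-]; rewrite setTI.
have mpos : measurable ([set v | 0 < enorm v] : set (borel_rV R d)).
  have := measurable_enorm measurableT (measurable_itv `]0 : R, +oo[).
  rewrite setTI [X in measurable X -> _](_ : _ = [set v | 0 < enorm v])//.
  by apply/seteqP; split => v /=; rewrite in_itv/= andbT.
rewrite (_ : _ @^-1` _ = ((direction : borel_rV R d -> borel_rV R d) @^-1` U `&`
    [set v | 0 < enorm v]) `|`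
    (if `[< U 0 >] then ~` [set v | 0 < enorm v] else set0)).
  apply: measurableU; last by case: ifP => _; [exact: measurableC|exact: measurable0].
  apply: sub_sigma_algebra => /=; rewrite openE => v [Uv v0].
  have cv : {for v, continuous (direction : 'rV[R]_d -> 'rV[R]_d)}.
    have cV : (enorm u)^-1 @[u --> v] --> (enorm v)^-1.
      by apply: (@cvgV R _ (nbhs v)); [rewrite gt_eqF|exact: continuous_enorm].
    exact: (@cvgZ R 'rV[R]_d _ (nbhs v) _ _ id _ v cV).
  have nU : nbhs (direction v) U by exact: open_nbhs_nbhs.
  have n0 : nbhs (enorm v) [set x : R | 0 < x] by exact: lt_nbhsr.
  exact: (@filterI _ (nbhs v) _ _ _ (cv _ nU) (@continuous_enorm v _ n0)).
apply/seteqP; split => v /=.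
  have [v0 Uv|v0] := ltP 0 (enorm v); first by left.
  rewrite /direction (_ : enorm v = 0) ?invr0 ?scale0r; last first.
    by apply/eqP; rewrite eq_le v0 enorm_ge0.
  by move=> U0; right; case: asboolP => // _ /=; rewrite ltNge v0.
move=> [[//]|]; case: asboolP => // U0 /= /negP; rewrite -leNgt => v0.
rewrite /direction (_ : enorm v = 0) ?invr0 ?scale0r//.
by apply/eqP; rewrite eq_le v0 enorm_ge0.
Qed.

Lemma sphere_boundaryC B : B `<=` sphere ->
  sphere_boundary (sphere `\` B) = sphere_boundary B.
Proof.
move=> Bs; rewrite /sphere_boundary setDD (setIidr Bs).
by rewrite -!setIA [closure B `&` _]setIC.
Qed.

(** Makes the expansion available on the whole sphere, that is for the tail of the norm. *)
Lemma sphere_boundaryT : sphere_boundary (sphere : set 'rV[R]_d) = set0.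
Proof. by rewrite /sphere_boundary setDv closure0 setI0. Qed.

End directions.

Section tail.
Context {R : realType} {d : nat} {dO : measure_display}.
Context {Omega : measurableType dO} (P : probability Omega R).

Lemma tail_expansion_bound (sigma : set (borel_rV R d) -> \bar R) (alpha beta : R)
    (xi : {RV P >-> borel_rV R d}) (B : set (borel_rV R d)) :
  tail_expansion sigma alpha beta xi -> measurable B -> B `<=` sphere ->
  sigma (sphere_boundary B) = 0%E ->
  exists K x0 : R, [/\ 0 <= K, 1 <= x0 & forall x, x0 <= x ->
  `|fine (P [set w | B (direction (xi w)) /\ x < enorm (xi w)]) -
    fine (sigma B) * x `^ (- alpha)| <= K * x `^ (- beta)].
Proof.
move=> tl mB Bs B0; have [C] := tl B mB Bs B0.
move=> /cvgrPdist_le /(_ 1 ltr01)[M [_ HM]].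
(* The remainder is eventually at most [x ^ -beta], which adds 1 to [|C|]; the limit speaks of
   points strictly beyond [M], hence [M + 1]. *)
exists (`|C| + 1), (Num.max 1 (M + 1)); split; first by rewrite addr_ge0.
  by rewrite le_max lexx.
move=> x; rewrite ge_max => /andP[x1 Mx].
have Mx' : M < x by apply: lt_le_trans Mx; rewrite ltrDl.
have xb : 0 < x `^ (- beta) by rewrite powR_gt0// (lt_le_trans ltr01).
have := HM x Mx'; rewrite sub0r normrN normrM normfV (gtr0_norm xb).
rewrite ler_pdivrMr// mul1r.
set F := fine _; set G := fine _ * _ => h.
rewrite (_ : F - G = (F - (G + C * x `^ (- beta))) + C * x `^ (- beta)); last by ring.
apply: (le_trans (ler_normD _ _)); rewrite normrM (gtr0_norm xb) mulrDl mul1r addrC.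
by rewrite lerD2l.
Qed.

End tail.

(** * Group leaders and the two outer binomial counts *)

Section groups.
Context {R : realType} {d : nat} {dO : measure_display}.
Context {Omega : measurableType dO} (P : probability Omega R).
Variables (xi : {RV P >-> borel_rV R d}) (xis : nat -> {RV P >-> borel_rV R d}).
Hypothesis xis_indep : independent_vectors xis.
Hypothesis xis_distr : forall k, same_distribution (xis k) xi.

Lemma independent_cylinder N (J : {set 'I_N}) (A : 'I_N -> set (borel_rV R d)) :
  (forall k, measurable (A k)) ->
  P (cylinder (fun k : 'I_N => xis k) J A) =
  (\prod_(k in J) P (xis k @^-1` A k))%E.
Proof.
move=> mA; pose A' k := if insub k is Some i then A i else setT.
have A'E (k : 'I_N) : A' k = A k by rewrite /A' valK.
have mA' k : measurable (A' k) by rewrite /A'; case: insubP.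
pose K := [fset k in [seq val i | i <- enum J]]%fset.
have := xis_indep K mA'.
rewrite (_ : \bigcap_(_ in _) _ = cylinder (fun k : 'I_N => xis k) J A).
  move=> ->; rewrite (@perm_big _ _ _ _ _ [seq val i | i <- enum J])/=.
    by rewrite big_map big_enum/=; apply: eq_bigr => i _; rewrite A'E.
  apply: uniq_perm; first exact: fset_uniq.
    by rewrite (map_inj_uniq val_inj) enum_uniq.
  by move=> k; rewrite !inE.
apply/seteqP; split => w Aw k.
  move=> kJ; rewrite -A'E; apply: Aw => /=.
  by rewrite !inE; apply: map_f; rewrite mem_enum.
move=> /=; rewrite !inE => /mapP[i]; rewrite mem_enum => iJ ->.
by rewrite /= A'E; exact: Aw.
Qed.

Definition tail (y : R) : R := fine (P [set w | y < enorm (xi w)]).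

Definition tail_in (B : set (borel_rV R d)) (y : R) : R :=
  fine (P [set w | B (direction (xi w)) /\ y < enorm (xi w)]).

Let mtail y : measurable [set w | y < enorm (xi w)].
Proof.
have := measurable_funPTI xi (measurable_above (fun=> y) measurable_enorm 0 measurableT).
by congr measurable; apply/seteqP; split => w //= [].
Qed.

Lemma tail01 y : 0 <= tail y <= 1.
Proof.
rewrite fine_ge0//= -lee_fin fineK ?fin_num_measure//; exact: probability_le1.
Qed.

Lemma tail_ni : {homo tail : x y / x <= y >-> y <= x}.
Proof.
move=> x y xy; apply: fine_le; rewrite ?fin_num_measure//.
apply: le_measure; rewrite ?inE// => w /=; exact: le_lt_trans.
Qed.

Lemma tail_sphere y : 0 <= y -> tail_in sphere y = tail y.
Proof.
move=> y0; rewrite /tail_in /tail; congr (fine (P _)); apply/seteqP; split => w /=.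
  by case.
by move=> yw; split => //; apply: direction_sphere; exact: le_lt_trans yw.
Qed.

Lemma prob_led_by_tail (x : nat -> R) J (B : set (borel_rV R d)) N (G : {set 'I_N}) M :
  nondecreasing_seq x -> measurable B -> #|G| = M.+1 ->
  P (led_by (fun k : 'I_N => xis k) enorm x J (direction @^-1` B) G) =
  (M.+1%:R * \sum_(j < J) tail_in B (x j.+1) *
    ((1 - tail (x j.+1)) ^+ M - (1 - tail (x j)) ^+ M))%:E.
Proof.
move=> x_nd mB GM.
have mD : measurable ((direction : borel_rV R d -> borel_rV R d) @^-1` B).
  by rewrite -[X in measurable X]setTI; exact: measurable_direction.
rewrite (@prob_led_by _ _ _ _ _ P _ (fun k : 'I_N => xis k) xi)//; first last.
- exact: independent_cylinder.
- by move=> k A mA; exact: xis_distr.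
- exact: measurable_enorm.
rewrite GM; congr (_ * _)%:E; apply: eq_bigr => j _.
have gE i : fine (P [set w | enorm (xi w) <= x i]) = 1 - tail (x i).
  rewrite (_ : [set w | _] = ~` [set w | x i < enorm (xi w)]).
    by rewrite probability_setC// fineB ?fin_num_measure.
  by apply/seteqP; split => w /=; rewrite leNgt => /negP.
by rewrite -!gE.
Qed.

End groups.

Section group_counts.
Context {R : realType} {d : nat} {dO : measure_display}.
Context {Omega : measurableType dO} (P : probability Omega R).
Variables (xi : {RV P >-> borel_rV R d}) (xis : nat -> {RV P >-> borel_rV R d}).
Hypothesis xis_indep : independent_vectors xis.
Hypothesis xis_distr : forall k, same_distribution (xis k) xi.

Definition success_count n (X : 'I_n -> {RV P >-> borel_rV R d})
    (B : set (borel_rV R d)) (w : Omega) : nat :=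
  (\sum_(i <- enum 'I_n) (w \in X i @^-1` (direction @^-1` B)))%N.

Lemma measurable_direction_preimage (B : set (borel_rV R d)) : measurable B ->
  measurable ((direction : borel_rV R d -> borel_rV R d) @^-1` B).
Proof.
by move=> mB; rewrite -[X in measurable X]setTI; exact: measurable_direction.
Qed.

Lemma measurable_success_count n (X : 'I_n -> {RV P >-> borel_rV R d})
    (B : set (borel_rV R d)) (Q : pred nat) : measurable B ->
  measurable [set w | Q (success_count X B w)].
Proof.
move=> mB; apply: measurable_count => i _; apply: measurable_funPTI.
exact: measurable_direction_preimage.
Qed.

Lemma studentized_success_count n (X : 'I_n -> {RV P >-> borel_rV R d})
    (B : set (borel_rV R d)) (p : R) w :
  studentized (fun i : 'I_n => \1_B (direction (X i w))) p =
  Num.sqrt n%:R * ((success_count X B w)%:R / n%:R - p) /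
  Num.sqrt ((success_count X B w)%:R / n%:R - ((success_count X B w)%:R / n%:R) ^+ 2).
Proof.
have meanE : mean (fun i : 'I_n => \1_B (direction (X i w)) : R) =
    (success_count X B w)%:R / n%:R.
  by rewrite /mean /success_count natr_sum -[in LHS]big_enum.
rewrite /studentized meanE (_ : (fun _ => _) = (fun i => \1_B (direction (X i w)))) ?meanE//.
apply/funext => i; rewrite indicE.
by case: (_ \in _); rewrite ?expr1n ?expr0n.
Qed.

Variables (N n M : nat) (G : 'I_n -> {set 'I_N}) (X : 'I_n -> {RV P >-> borel_rV R d}).
Hypothesis n_gt0 : (0 < n)%N.
Hypothesis G_groups : groups M.+1 G.
Hypothesis X_largest : forall i, largest_in_group xis (G i) (X i).
Variables (x : nat -> R) (J : nat).
Hypothesis x_nd : nondecreasing_seq x.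
Variable B : set (borel_rV R d).
Hypothesis mB : measurable B.

Definition lead_prob (C : set (borel_rV R d)) : R :=
  M.+1%:R * \sum_(j < J) tail_in xi C (x j.+1) *
    ((1 - tail xi (x j.+1)) ^+ M - (1 - tail xi (x j)) ^+ M).

Let led (C : set (borel_rV R d)) (i : 'I_n) : set Omega :=
  led_by (fun k : 'I_N => xis k) enorm x J (direction @^-1` C) (G i).

Let P_led C i : measurable C -> P (led C i) = (lead_prob C)%:E.
Proof.
move=> mC; have [GM _] := G_groups.
exact: (prob_led_by_tail xis_indep xis_distr J x_nd mC (GM i)).
Qed.

Let led_determined C i : measurable C ->
  determined_by (fun k : 'I_N => xis k) (G i) (led C i).
Proof.
move=> mC; apply: determined_by_led_by; first exact: measurable_enorm.
exact: measurable_direction_preimage.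
Qed.

Let count_law (E : 'I_n -> set Omega) q :
  (forall i, determined_by (fun k : 'I_N => xis k) (G i) (E i)) ->
  (forall i, P (E i) = q%:E) ->
  binomial_law P n q (fun w => \sum_(i <- enum 'I_n) (w \in E i))%N.
Proof.
move=> dE PE Q; split.
  apply: measurable_count => i _; exact: determined_by_measurable (dE i).
rewrite (@binomial_count _ _ _ _ _ P _ (fun k : 'I_N => xis k) _ _ _ G E q Q).
- by rewrite size_enum_ord.
- exact: independent_cylinder.
- exact: enum_uniq.
- by move=> i j _ _ ij; case: G_groups => _; exact.
- by move=> i _; exact: dE.
- by move=> i _; exact: PE.
Qed.

Let mC : measurable (sphere `\` B : set (borel_rV R d)).
Proof. by apply: measurableD => //; exact: measurable_sphere. Qed.

(* A group in neither [led B i] nor [led (sphere `\` B) i] may have ties, which the choice of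
   the maximiser is free to resolve. *)
Lemma success_count_sandwich : exists a c : Omega -> nat,
  [/\ binomial_law P n (lead_prob B) a,
   binomial_law P n (1 - lead_prob (sphere `\` B)) c,
   lead_prob B + lead_prob (sphere `\` B) <= 1 &
   forall w, (a w <= success_count X B w <= c w)%N].
Proof.
exists (fun w => \sum_(i <- enum 'I_n) (w \in led B i))%N,
  (fun w => \sum_(i <- enum 'I_n) (w \in ~` led (sphere `\` B) i))%N.
split.
- by apply: count_law => i; [exact: led_determined|exact: P_led].
- apply: count_law => i.
    exact: (determined_byC (@led_determined _ i mC)).
  rewrite probability_setC; last exact: determined_by_measurable (@led_determined _ i mC).
  by rewrite P_led// -EFinB.
(* Two disjoint events in a single group give the inequality; [n_gt0] provides such a group. *)
- have mL := determined_by_measurable (@led_determined _ (Ordinal n_gt0) mB).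
  have mLC := determined_by_measurable (@led_determined _ (Ordinal n_gt0) mC).
  have := probability_le1 P (measurableU _ _ mL mLC).
  rewrite measureU//; last first.
    apply: led_by_disjoint; apply/seteqP; split => // v /= [Bv [_ nBv]]; exact: nBv.
  have -> : (P (led B (Ordinal n_gt0)) + P (led (sphere `\` B) (Ordinal n_gt0)) =
    (lead_prob B + lead_prob (sphere `\` B))%:E)%E by rewrite !P_led.
  by rewrite lee_fin.
- move=> w; apply/andP; split; apply: leq_sum => i _.
    have [/set_mem Lw|//] := boolP (w \in led B i).
    have [k kG [Xk kmax]] := X_largest i w.
    rewrite mem_set//= Xk; exact: (led_by_max Lw kG kmax).
  have [/set_mem Bw|//] := boolP (w \in _ @^-1` _).
  rewrite mem_set// => Lw.
  have [k kG [Xk kmax]] := X_largest i w.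
  have [_ /=] := led_by_max Lw kG kmax; apply.
  by move: Bw; rewrite /= Xk.
Qed.

End group_counts.

(** * From the tail expansion to a lower bound for the leader probability *)

Section bias.
Context {R : realType} {d : nat} {dO : measure_display}.
Context {Omega : measurableType dO} (P : probability Omega R).
Variables (xi : {RV P >-> borel_rV R d})
  (sigma : {finite_measure set (borel_rV R d) -> \bar R}) (alpha beta : R).
Hypotheses (alpha_gt0 : 0 < alpha) (lt_alpha_beta : alpha < beta)
  (xi_tail : tail_expansion sigma alpha beta xi).

Lemma lead_prob_ge (p : R) (B : set (borel_rV R d)) :
  measurable B -> B `<=` sphere -> sigma (sphere_boundary B) = 0%E ->
  0 < fine (sigma sphere) -> 0 <= p <= 1 -> fine (sigma B) = p * fine (sigma sphere) ->
  exists K y0 : R, [/\ 0 <= K, 1 <= y0 &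
  forall y, y0 <= y -> forall J M, grid alpha beta y J `^ (- alpha) <= y `^ (- beta) ->
  p - M.+1%:R * (K * y `^ (- beta) +
      expR (- (fine (sigma sphere) / 2 * M%:R * y `^ (- alpha)))) <=
  lead_prob xi M (grid alpha beta y) J B].
Proof.
set s := fine (sigma sphere) => mB Bs B0 s0 p01 sB.
have [KB [yB [KB0 yB1 HB]]] := tail_expansion_bound xi_tail mB Bs B0.
have S0 : sigma (sphere_boundary sphere) = 0%E by rewrite sphere_boundaryT measure0.
have [KS [yS [KS0 yS1 HS]]] :=
  tail_expansion_bound xi_tail measurable_sphere (@subset_refl _ _) S0.
pose K := KB + KS.
have K0 : 0 <= K by rewrite addr_ge0.
(* Beyond [y1] the error [K * y ^ -beta] is at most half of [s * y ^ -alpha], so [tail xi y] is at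
   least [s / 2 * y ^ -alpha], and [(1 - tail xi y) ^+ M] is below the stated exponential. *)
pose y1 := (2 * K / s) `^ (beta - alpha)^-1.
exists (2 * s + 3 * K), (Num.max (Num.max yB yS) y1); split.
- by rewrite addr_ge0// mulr_ge0// ltW.
- by rewrite !le_max yB1.
move=> y; rewrite !ge_max -andbA => /and3P[yBy ySy y1y] J M yJ.
have yge1 : 1 <= y by exact: le_trans yBy.
have y0 : 0 < y by exact: lt_le_trans yge1.
have boundS x : y <= x -> `|tail xi x - s * x `^ (- alpha)| <= KS * x `^ (- beta).
  move=> yx; rewrite -tail_sphere; last exact/ltW/(lt_le_trans y0).
  exact: HS (le_trans ySy yx).
have boundB x : y <= x -> `|tail_in xi B x - p * s * x `^ (- alpha)| <= KB * x `^ (- beta).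
  by move=> yx; rewrite -sB; exact: HB (le_trans yBy yx).
have Kle L x : L <= K -> L * x `^ (- beta) <= K * x `^ (- beta).
  by move=> LK; rewrite ler_wpM2r// powR_ge0.
apply: le_trans (@grid_tail_bound _ alpha beta y s p K (tail xi) (tail_in xi B)
  alpha_gt0 lt_alpha_beta yge1 (ltW s0) K0 p01 (tail01 xi) (@tail_ni _ _ _ _ _ xi)
  _ _ J M yJ).
- rewrite lerD2l lerN2 ler_wpM2l// lerD2l.
  have /andP[h0 h1] := tail01 xi y.
  apply: (@le_trans _ _ (expR (- tail xi y) ^+ M)).
    by rewrite lerXn2r ?nnegrE ?expR_ge0 ?subr_ge0//; exact: expR_ge1Dx.
  rewrite -expRM_natl ler_expR mulrN lerN2 mulrAC [_ * M%:R]mulrC ler_wpM2l//.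
  have := boundS y (lexx y); rewrite ler_norml => /andP[+ _].
  rewrite lerBrDr; apply: le_trans; rewrite addrC lerBrDr -lerBrDl.
  have -> : s * y `^ (- alpha) - s / 2 * y `^ (- alpha) = s / 2 * y `^ (- alpha) by field.
  apply: (le_trans (Kle KS y _)); first by rewrite lerDr.
  have -> : - alpha = (beta - alpha) + - beta by ring.
  rewrite powRD ?(gt_eqF y0) ?implybT// mulrA ler_wpM2r ?powR_ge0//.
  have ba : 0 < beta - alpha by rewrite subr_gt0.
  have : y1 `^ (beta - alpha) <= y `^ (beta - alpha).
    by apply: ge0_ler_powR; rewrite ?nnegrE ?powR_ge0 ?(ltW ba) ?(ltW y0).
  rewrite /y1 -powRrM mulVf ?(gt_eqF ba)// powRr1; last by rewrite divr_ge0 ?mulr_ge0// ltW.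
  rewrite ler_pdivrMr//.
  by have -> : (K <= s / 2 * y `^ (beta - alpha)) = (2 * K <= y `^ (beta - alpha) * s);
    [apply/idP/idP; lra|].
- move=> x yx; have := boundS x yx; rewrite ler_norml => /andP[_].
  by rewrite lerBlDl => /le_trans; apply; rewrite lerD2l Kle// lerDr.
- move=> x yx; have := boundB x yx; rewrite ler_norml => /andP[+ _].
  rewrite lerBrDl; apply: le_trans; rewrite lerD2l lerN2 Kle// lerDl//.
Qed.

End bias.

(** Turns the one-sided estimates for a set and for its complement into two-sided ones for both
    binomial parameters. *)
Lemma close_of_lower_bounds (R : realDomainType) (a b p e : R) :
  p - e <= a -> 1 - p - e <= b -> a + b <= 1 -> `|a - p| <= e /\ `|1 - b - p| <= e.
Proof. by move=> *; rewrite !ler_norml; split; apply/andP; split; lra. Qed.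

Lemma close_of_close_bounds (R : realFieldType) (x l u y e' e : R) :
  l - e' <= y -> y <= u + e' -> `|x - l| <= e / 2 -> `|x - u| <= e / 2 -> e' <= e / 2 ->
  `|x - y| <= e.
Proof.
by move=> ? ?; rewrite !ler_norml => /andP[? ?] /andP[? ?] ?; apply/andP; split; lra.
Qed.

Theorem theorem3p2 (R : realType) (d : nat) (dO : measure_display)
    (Omega : measurableType dO) (P : probability Omega R)
    (xi : {RV P >-> borel_rV R d}) (xis : nat -> {RV P >-> borel_rV R d})
    (xis_indep : independent_vectors xis)
    (xis_distr : forall k, same_distribution (xis k) xi)
    (sigma : {finite_measure set (borel_rV R d) -> \bar R})
    (sigma_sphere : sigma (~` sphere) = 0%E)
    (alpha beta : R) (alpha_gt0 : 0 < alpha) (lt_alpha_beta : alpha < beta)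
    (xi_tail : tail_expansion sigma alpha beta xi)
    (zeta : R) (zetaE : zeta = Num.min ((beta - alpha) / alpha) 1)
    (eps : R) (eps_gt0 : 0 < eps) (eps_small : eps < 2 * zeta / (1 + 2 * zeta))
    (n m : nat -> nat)
    (nE : forall N, n N = Num.truncn (N%:R `^ (2 * zeta / (1 + 2 * zeta) - eps)))
    (mE : (forall N, m N = Num.truncn (N%:R `^ (1 / (1 + 2 * zeta) + eps))) \/
          (forall N, m N = (N %/ n N)%N))
    (G : forall N, 'I_(n N) -> {set 'I_N})
    (G_groups : forall N, groups (m N) (G N))
    (X : forall N, 'I_(n N) -> {RV P >-> borel_rV R d})
    (X_largest : forall N (i : 'I_(n N)), largest_in_group xis (G N i) (X N i))
    (B : set (borel_rV R d)) (B_borel : measurable B) (B_sphere : B `<=` sphere)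
    (B_boundary : sigma (sphere_boundary B) = 0%E)
    (B_nondegenerate : (0 < sigma B < sigma sphere)%E) :
  cvg_in_distribution P
    (fun N w => studentized (fun i : 'I_(n N) => \1_B (direction (X N i w)))
                            (fine (sigma B) / fine (sigma sphere)))
    (normal_prob 0 1).
Proof.
have mB := B_borel.
have sigma_fin (C : set (borel_rV R d)) : measurable C -> sigma C = (fine (sigma C))%:E.
  by move=> mC; rewrite fineK// fin_num_measure.
set s := fine (sigma sphere); set p := fine (sigma B) / s.
have /andP[B0 Bs] := B_nondegenerate.
have sB0 : 0 < fine (sigma B) by rewrite -lte_fin -sigma_fin.
have sBs : fine (sigma B) < s by rewrite -lte_fin -!sigma_fin//; exact: measurable_sphere.
have s0 : 0 < s by exact: lt_trans sBs.
have p01 : 0 < p < 1 by rewrite divr_gt0//= ltr_pdivrMr// mul1r.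
have p01' : 0 <= p <= 1 by case/andP: p01 => /ltW -> /ltW ->.
have q01' : 0 <= 1 - p <= 1 by move: p01' => /andP[? ?]; apply/andP; split; lra.
have sBE : fine (sigma B) = p * s by rewrite divfK// gt_eqF.
have mC : measurable (sphere `\` B : set (borel_rV R d)).
  by apply: measurableD => //; exact: measurable_sphere.
have sCE : fine (sigma (sphere `\` B)) = (1 - p) * s.
  have := @measureD _ _ _ sigma _ _ measurable_sphere mB; rewrite (setIidr B_sphere) => -> //.
    by rewrite fineB ?fin_num_measure//; [rewrite sBE mulrBl mul1r|exact: measurable_sphere].
  by rewrite ltey_eq fin_num_measure//; exact: measurable_sphere.
have C_boundary : sigma (sphere_boundary (sphere `\` B)) = 0%E by rewrite sphere_boundaryC.
have [KB [yB [KB0 yB1 HB]]] :=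
  lead_prob_ge alpha_gt0 lt_alpha_beta xi_tail mB B_sphere B_boundary s0 p01' sBE.
have [KC [yC [KC0 yC1 HC]]] :=
  lead_prob_ge alpha_gt0 lt_alpha_beta xi_tail mC (@subDsetl _ _ _) C_boundary s0 q01' sCE.
pose b N w := success_count (X N) B w.
(* The bias [delta] consists of a power term and an exponential term; after multiplication by
   [sqrt n] each is allowed half of [kappa]. *)
have counts kappa : 0 < kappa -> \forall N \near \oo, exists q1 q2 a c,
    [/\ Num.sqrt (n N)%:R * `|q1 - p| <= kappa, Num.sqrt (n N)%:R * `|q2 - p| <= kappa,
     binomial_law P (n N) q1 a, binomial_law P (n N) q2 c &
     forall w, (a w <= b N w <= c w)%N].
  move=> kappa0.
  pose K := KB + KC.
  have K0 : 0 <= K by rewrite addr_ge0.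
  have K1 : 0 < 2 * (K + 1) by rewrite mulr_gt0// ltr_wpDl.
  (* [K + 1] rather than [K], which may be 0. *)
  have kK0 : 0 < kappa / (2 * (K + 1)) by rewrite divr_gt0.
  have k20 : 0 < kappa / 2 by rewrite divr_gt0.
  have s20 : 0 < s / 2 by rewrite divr_gt0.
  near=> N.
  have yBy : yB <= threshold alpha beta zeta eps N by near: N; exact: near_threshold.
  have yCy : yC <= threshold alpha beta zeta eps N by near: N; exact: near_threshold.
  have n_gt0 : (0 < n N)%N.
    by rewrite -(ler1n R); near: N; apply: near_n_gt eps_small nE _.
  have m_gt0 : (0 < m N)%N.
    rewrite -(ltr0n R); have /andP[mN _] : N%:R `^ (1 / (1 + 2 * zeta) + eps) / 2 <=
      (m N)%:R <= 2 * N%:R `^ (1 / (1 + 2 * zeta) + eps)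
      by near: N; exact: (near_m alpha_gt0 lt_alpha_beta zetaE eps_gt0 eps_small nE mE).
    apply: lt_le_trans mN; rewrite divr_gt0// powR_gt0// ltr0n.
    by near: N; exact: nbhs_infty_gt.
  have rate1 : Num.sqrt (n N)%:R * (m N)%:R *
      threshold alpha beta zeta eps N `^ (- beta) <= kappa / (2 * (K + 1)).
    by near: N; exact: (near_bias_power alpha_gt0 lt_alpha_beta zetaE eps_gt0 eps_small nE mE).
  have rate2 : Num.sqrt (n N)%:R * (m N)%:R *
      expR (- (s / 2 * (m N).-1%:R * threshold alpha beta zeta eps N `^ (- alpha))) <= kappa / 2.
    by near: N; exact: (near_bias_exp alpha_gt0 lt_alpha_beta zetaE eps_gt0 eps_small nE mE).
  set y := threshold alpha beta zeta eps N in yBy yCy rate1 rate2.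
  have y0 : 0 < y by apply: lt_le_trans yBy; exact: lt_le_trans yB1.
  have [J yJ] := grid_last beta alpha_gt0 y0.
  have GN : groups (m N).-1.+1 (G N) by rewrite prednK.
  have [a [c [la lc qBC abc]]] := success_count_sandwich xis_indep xis_distr n_gt0 GN
    (X_largest N) J (grid_nd beta alpha_gt0 y0) mB.
  have := HB y yBy J (m N).-1 yJ; have := HC y yCy J (m N).-1 yJ.
  rewrite prednK// -/s; set v := y `^ (- beta) in rate1 *.
  set E := expR _ in rate2 *; set r := Num.sqrt _ in rate1 rate2 *.
  set qB := lead_prob _ _ _ _ B in la qBC *.
  set qC := lead_prob _ _ _ _ (sphere `\` B) in lc qBC *.
  move=> qCge qBge; exists qB, (1 - qC), a, c.
  pose delta := (m N)%:R * (K * v + E).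
  have v0 : 0 <= v by exact: powR_ge0.
  have Kv L : L <= K -> (m N)%:R * (L * v + E) <= delta.
    by move=> LK; rewrite ler_wpM2l// lerD2r ler_wpM2r.
  have qBd : p - delta <= qB.
    by apply: le_trans qBge; rewrite lerD2l lerN2 Kv// lerDl.
  have qCd : 1 - p - delta <= qC.
    by apply: le_trans qCge; rewrite lerD2l lerN2 Kv// lerDr.
  have rdelta : r * delta <= kappa.
    rewrite (_ : r * delta = K * (r * (m N)%:R * v) + r * (m N)%:R * E); last first.
      by rewrite /delta; ring.
    have := ler_wpM2l K0 rate1.
    have : K * (kappa / (2 * (K + 1))) <= kappa / 2.
      rewrite mulrA ler_pdivrMr// (_ : kappa / 2 * _ = kappa * (K + 1)); last by field.
      by rewrite mulrC ler_pM2l// lerDl.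
    move: rate2; move: (r * _ * v) (r * _ * E) (K * _) => A1 A2 A3; lra.
  have rq q : `|q - p| <= delta -> r * `|q - p| <= kappa.
    by move=> qd; apply: le_trans rdelta; rewrite ler_wpM2l// sqrtr_ge0.
  have [qB_close qC_close] := close_of_lower_bounds qBd qCd qBC.
  by split=> //; exact: rq.
move=> t ct.
have cdfE : normal_prob 0 1 `]-oo, t] = (normal_cdf t)%:E.
  by rewrite /normal_cdf fineK// fin_num_measure.
have setE N : [set w | studentized (fun i : 'I_(n N) => \1_B (direction (X N i w))) p <= t] =
    [set w | Num.sqrt (n N)%:R * ((b N w)%:R / (n N)%:R - p) /
      Num.sqrt ((b N w)%:R / (n N)%:R - ((b N w)%:R / (n N)%:R) ^+ 2) <= t].
  by apply/seteqP; split => w /=; rewrite studentized_success_count.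
rewrite cdfE; apply: cvg_EFin.
  near=> N; rewrite setE fin_num_measure//.
  exact: (measurable_success_count (X N) (fun k => Num.sqrt (n N)%:R *
    (k%:R / (n N)%:R - p) / Num.sqrt (k%:R / (n N)%:R - (k%:R / (n N)%:R) ^+ 2) <= t) mB).
apply/cvgrPdist_le => e e0.
have e20 : 0 < e / 2 by rewrite divr_gt0.
move: ct => /cvgrPdist_le/(_ _ e20)/nbhs_ballP[delta /= delta0 ctd].
(* [e / 2] bounds the additive error, and [delta / 2] keeps the shifted arguments strictly inside
   the ball where continuity at [t] controls the limit up to [e / 2]. *)
pose e' := Num.min (e / 2) (delta / 2).
have e'0 : 0 < e' by rewrite lt_min e20 divr_gt0.
have [kappa kappa0 bound] := sandwich_bound P t p01 e'0.
near=> N.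
have [q1 [q2 [a [c [h1 h2 la lc abc]]]]] : exists q1 q2 a c,
    [/\ Num.sqrt (n N)%:R * `|q1 - p| <= kappa, Num.sqrt (n N)%:R * `|q2 - p| <= kappa,
     binomial_law P (n N) q1 a, binomial_law P (n N) q2 c &
     forall w, (a w <= b N w <= c w)%N] by near: N; exact: counts.
have nk : kappa^-1 <= (n N)%:R.
  by near: N; apply: near_n_gt eps_small nE _.
have [low up] := bound _ _ _ _ _ _ nk h1 h2 la lc
  (fun Q => measurable_success_count (X N) Q mB) abc.
have close u : `|u - t| <= e' -> `|normal_cdf t - normal_cdf u| <= e / 2.
  move=> ut; apply: ctd; rewrite /ball/= distrC.
  apply: (le_lt_trans ut); apply: (@le_lt_trans _ _ (delta / 2)).
    by rewrite ge_min lexx orbT.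
  by rewrite ltr_pdivrMr// mulr_natr mulr2n ltrDl.
have c1 : `|normal_cdf t - normal_cdf (t - e')| <= e / 2.
  by apply: close; rewrite addrC addKr normrN gtr0_norm.
have c2 : `|normal_cdf t - normal_cdf (t + e')| <= e / 2.
  by apply: close; rewrite addrC addKr gtr0_norm.
have e'e : e' <= e / 2 by rewrite ge_min lexx.
rewrite /= setE.
exact: close_of_close_bounds low up c1 c2 e'e.
Unshelve. all: by end_near. Qed.
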